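(* Let $\mathcal{H}=(C,F,D,G)$ be a hybrid system on $\mathbb{R}^n$, and given an initial condition $x_0$, suppose that $\mathcal{H}$ is outer well-posed and nominally inner well-posed at $x_0$ and pre-forward complete from $x_0$. Given $(T,J)\in\mathbb{R}_{\geq0}\times\mathbb{N}$, suppose that the reachable set $\mathcal{R}_{\mathcal{H}}(x_0,T,J)$ is nonempty and for every $\xi\in\mathcal{R}_{\mathcal{H}}(x_0,T,J)$ there exists $x\in\mathcal{S}_{\mathcal{H}}(x_0)$ such that $\xi=x(T,J)$ and $T$ is not a jump time or the terminal ordinary time of $x$. Consider a cost function $\mathcal{J}$ that is continuous at all $\xi'\in\{x_0\}\times\{(T,J)\}\times\mathbb{R}^n$. Let $\mathcal{O}_{\mathcal{H}}(x_0',T',J')$ be the set of optimal solutions of the optimal control problem with hybrid system $\mathcal{H}$, constraint set $\{x_0'\}\times\{(T',J')\}\times\mathbb{R}^n$ and cost function $\mathcal{J}$. Then the following statements are true. 1. (Local boundedness) There exist $\varepsilon>0$ and a compact set $K$ such that for all $x_0'\in x_0+\varepsilon\mathbb{B}$ and $(T',J')\in((T,J)+\varepsilon\mathbb{B})\cap(\mathbb{R}_{\geq0}\times\mathbb{N})$, one has $x(t,j)\in K$ for all $x\in\mathcal{O}_{\mathcal{H}}(x_0',T',J')$ and $(t,j)\in\mathrm{dom}\,x$. 2. (Outer semicontinuity) Let $\{x_i'\}_{i=0}^\infty$ be a graphically convergent sequence such that $x_i'\in\mathcal{O}_{\mathcal{H}}(\xi_i,T_i,J_i)$ for all $i\geq0$.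 If $\{\xi_i\}$ and $\{(T_i,J_i)\}$ converge to $x_0$ and $(T,J)$, respectively, then $x\in\mathcal{O}_{\mathcal{H}}(x_0,T,J)$, where $x$ is the graphical limit of $\{x_i'\}$. 3. (Upper semicontinuity) For all $\tau\geq0$ and $\varepsilon>0$ there exists $\eta>0$ such that for every $x_0'\in x_0+\eta\mathbb{B}$, $(T',J')\in((T,J)+\eta\mathbb{B})\cap(\mathbb{R}_{\geq0}\times\mathbb{N})$ and $x'\in\mathcal{O}_{\mathcal{H}}(x_0',T',J')$, there exists $x\in\mathcal{O}_{\mathcal{H}}(x_0,T,J)$ such that $x$ and $x'$ are $(\tau,\varepsilon)$-close.
   Context: $\mathbb{N}=\{0,1,2,\dots\}$; $\mathbb{B}$ is the closed unit ball of the relevant Euclidean space. A hybrid system $\mathcal{H}=(C,F,D,G)$ on $\mathbb{R}^n$ consists of sets $C,D\subset\mathbb{R}^n$ and set-valued maps $F,G:\mathbb{R}^n\rightrightarrows\mathbb{R}^n$ with $C\subset\mathrm{dom}\,F$, $D\subset\mathrm{dom}\,G$ (where $\mathrm{dom}$ of a set-valued map is the set where its values are nonempty), and represents $\dot x\in F(x)$ for $x\in C$, $x^+\in G(x)$ for $x\in D$. A set $E\subset\mathbb{R}_{\geq0}\times\mathbb{N}$ is a hybrid time domain if for every $(T,J)\in E$ there is a nondecreasing sequence $\{t_j\}_{j=0}^{J+1}$ with $t_0=0$ and $E\cap([0,T]\times\{0,\dots,J\})=\bigcup_{j=0}^{J}([t_j,t_{j+1}]\times\{j\})$. A hybrid arc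 is a function $x:\mathrm{dom}\,x\to\mathbb{R}^n$ such that $\mathrm{dom}\,x$ is a hybrid time domain and for each $j$, $t\mapsto x(t,j)$ is locally absolutely continuous on $I^j:=\{t:(t,j)\in\mathrm{dom}\,x\}$. It is a solution of $\mathcal{H}$ if $x(0,0)\in\mathrm{cl}(C)\cup D$; for each $j$, $x(t,j)\in C$ for all $t\in\mathrm{int}\,I^j$ and $\dot x(t,j)\in F(x(t,j))$ for almost all $t\in I^j$; and whenever $(t,j),(t,j+1)\in\mathrm{dom}\,x$, $x(t,j)\in D$ and $x(t,j+1)\in G(x(t,j))$. A solution originates from $x_0$ if $x(0,0)=x_0$. It is maximal if it cannot be extended to another solution, complete if its domain is unbounded, bounded if its range is bounded. It escapes to infinity at hybrid time $(T,J)$ if $|x(t,J)|\to\infty$ as $t$ tends to $T$ from the left. $\mathcal{S}_{\mathcal{H}}(x_0)$ is the set of maximal solutions originating from $x_0$; $\mathcal{H}$ is pre-forward complete from $x_0$ if every $x\in\mathcal{S}_{\mathcal{H}}(x_0)$ is bounded or complete. The reachable set is $\mathcal{R}_{\mathcal{H}}(x_0,T,J):=\{x(T,J):x\in\mathcal{S}_{\mathcal{H}}(x_0),\ (T,J)\in\mathrm{dom}\,x\}$, for $x_0\in\mathrm{cl}(C)\cup D$. A time $t$ is a jump time of $x$ if $(t,j),(t,j+1)\in\mathrm{dom}\,x$ for some $j$. If $\mathrm{dom}\,x$ is compact, its terminal hybrid time is the $(T,J)\in\mathrm{dom}\,x$ with $t\leq T$, $j\leq J$ for all $(t,j)\in\mathrm{dom}\,x$,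 and $T$ is its terminal ordinary time. $\widehat{\mathcal{S}}_{\mathcal{H}}$ is the set of all solutions of $\mathcal{H}$ (not necessarily maximal) with compact domain. A sequence $\{x_i\}$ of hybrid arcs is locally eventually bounded if for any $\tau\geq0$ there exist $i_0\geq 0$ and a compact set $K'$ such that $x_i(t,j)\in K'$ for all $i\geq i_0$ and $(t,j)\in\mathrm{dom}\,x_i$ with $t+j\leq\tau$. It converges graphically to a set-valued map $N:\mathbb{R}_{\geq0}\times\mathbb{N}\rightrightarrows\mathbb{R}^n$ (its graphical limit) if the graphs of $x_i$ converge to the graph of $N$ in the Painlevé–Kuratowski sense. Two hybrid arcs $x,x'$ are $(\tau,\varepsilon)$-close if for every $(t,j)\in\mathrm{dom}\,x$ with $t+j\leq\tau$ there is $(t',j)\in\mathrm{dom}\,x'$ with $|t-t'|<\varepsilon$ and $|x(t,j)-x'(t',j)|<\varepsilon$, and the same holds with the roles of $x$ and $x'$ exchanged. Given $\rho:\mathbb{R}^n\to\mathbb{R}_{\geq0}$, the $\rho$-perturbation of $\mathcal{H}$ is $\mathcal{H}^\rho=(C^\rho,F^\rho,D^\rho,G^\rho)$ with $C^\rho=\{x:(x+\rho(x)\mathbb{B})\cap C\neq\varnothing\}$, $D^\rho=\{x:(x+\rho(x)\mathbb{B})\cap D\neq\varnothing\}$, $F^\rho(x)=\mathrm{cl}(\mathrm{con}\,F((x+\rho(x)\mathbb{B})\cap C))+\rho(x)\mathbb{B}$ ($\mathrm{con}$ = convex hull), $G^\rho(x)=\{z: z\in y+\rho(y)\mathbb{B},\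 y\in G((x+\rho(x)\mathbb{B})\cap D)\}$. $\mathcal{H}^{\delta\rho}$ is the perturbation corresponding to the function $x\mapsto\delta\rho(x)$. $\mathcal{H}$ is outer well-posed at $x_0$ if for every continuous $\rho:\mathbb{R}^n\to\mathbb{R}_{\geq0}$, every positive sequence $\{\delta_i\}$ in $(0,1)$ convergent to zero, and every graphically convergent sequence of hybrid arcs $\{x_i\}$ such that $x_i$ is a solution of $\mathcal{H}^{\delta_i\rho}$ and $\lim_i x_i(0,0)=x_0$: (i) if $\{x_i\}$ is locally eventually bounded, the graphical limit is a solution of $\mathcal{H}$ originating from $x_0$; (ii) otherwise there is $(T,J)\in\mathbb{R}_{\geq0}\times\mathbb{N}$ such that $x=N|_{\mathrm{dom}\,N\cap([0,T)\times\{0,\dots,J\})}$ is a solution of $\mathcal{H}$ originating from $x_0$ that escapes to infinity at hybrid time $(T,J)$, where $N$ is the graphical limit. $\mathcal{H}$ is nominally inner well-posed at $x_0$ if for every solution $x$ of $\mathcal{H}$ originating from $x_0$: given any sequence $\{\xi_i\}$ in $\mathrm{cl}(C)\cup D$ convergent to $x(0,0)$, for every $i$ there is a solution $x_i$ of $\mathcal{H}$ originating from $\xi_i$ such that (a) if $x$ is bounded or complete and $\mathrm{dom}\,x$ is closed, then $\{x_i\}$ is locally eventually bounded and graphically convergent to $x$; (b) if $x$ escapes to infinity at hybrid time $(T,J)$, then $\{x_i\}$ is not locally eventually bounded but is graphically convergent to a mapping $N$ with $x=N|_{\mathrm{dom}\,N\cap([0,T)\times\{0,\dots,J\})}$. A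 cost function is a function $\mathcal{J}:\mathbb{R}^n\times\mathbb{R}_{\geq0}\times\mathbb{N}\times\mathbb{R}^n\to\mathbb{R}_{\geq0}$. The optimal control problem with hybrid system $\mathcal{H}$, constraint set $\Omega'\subset\mathbb{R}^n\times\mathbb{R}_{\geq0}\times\mathbb{N}\times\mathbb{R}^n$ and cost function $\mathcal{J}$ is to minimize $\mathcal{J}(x(0,0),(T,J),x(T,J))$ over $x\in\widehat{\mathcal{S}}_{\mathcal{H}}$ subject to $(x(0,0),(T,J),x(T,J))\in\Omega'$, where $(T,J)$ is the terminal hybrid time of $x$. A feasible solution is an $x\in\widehat{\mathcal{S}}_{\mathcal{H}}$ satisfying the constraint, and an optimal solution is a feasible solution attaining the infimum of the cost over all feasible solutions (the set of optimal solutions may be empty).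
   Formalization: Hybrid time domains are additionally required to be totally ordered (t ≤ t' and j ≤ j'), i.e. successive intervals; the truncation condition read literally also admits branching sets such as [0,2]×{0} ∪ {(1,1)}, for which item 2 fails. *)

(* Defs.v *)
From HB Require Import structures.
From mathcomp Require Import all_boot all_order all_algebra.
From mathcomp Require Import all_classical all_reals all_analysis.

Set Implicit Arguments.
Unset Strict Implicit.
Unset Printing Implicit Defensive.

Import Order.TTheory GRing.Theory Num.Theory.
Import numFieldNormedType.Exports.

Local Open Scope classical_set_scope.
Local Open Scope ring_scope.

(* The library norm of 'rV[R]_n is the sup norm; balls and distances below are
   Euclidean. Topological notions (closure, compactness, limits, derivatives)
   are the library's, the two norms being equivalent. *)
Definition enorm (R : realType) (n : nat) (v : 'rV[R]_n) : R :=
  Num.sqrt (\sum_i v ord0 i ^+ 2).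

Definition cball (R : realType) (n : nat) (x : 'rV[R]_n) (r : R) :
  set 'rV[R]_n := [set y | enorm (y - x) <= r].

Definition hdist (R : realType) (p q : R * nat) : R :=
  Num.sqrt ((p.1 - q.1) ^+ 2 + (p.2%:R - q.2%:R) ^+ 2).

Definition conv_hull (R : realType) (n : nat) (S : set 'rV[R]_n) :
    set 'rV[R]_n :=
  \bigcap_(A in [set A : set 'rV[R]_n |
                  @convex_set R 'rV[R]_n A /\ S `<=` A]) A.

Definition sv_image (T U : Type) (F : T -> set U) (S : set T) : set U :=
  \bigcup_(x in S) F x.

Definition sv_graph (T U : Type) (F : T -> set U) : set (T * U) :=
  [set p | F p.1 p.2].

Definition sv_restrict (T U : Type) (F : T -> set U) (S : set T) :
  T -> set U := fun x => [set z | S x /\ F x z].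

Record hybrid_data (R : realType) (n : nat) := HybridData {
  flow_set : set 'rV[R]_n;
  flow_map : 'rV[R]_n -> set 'rV[R]_n;
  jump_set : set 'rV[R]_n;
  jump_map : 'rV[R]_n -> set 'rV[R]_n
}.

Definition is_hybrid_system (R : realType) (n : nat) (H : hybrid_data R n) :=
  (forall x, flow_set H x -> flow_map H x !=set0) /\
  (forall x, jump_set H x -> jump_map H x !=set0).

(* The second conjunct is the usual description of a hybrid time domain by
   truncations. Truncations alone would also admit branching sets such as
   [0,2] x {0} together with (1,1); the third conjunct rules these out, so that a domain
   is a finite or infinite succession of intervals [t_j, t_{j+1}] x {j}, the
   last one possibly half-open or unbounded. *)
Definition hybrid_time_domain (R : realType) (E : set (R * nat)) :=
  [/\ (forall p, E p -> 0 <= p.1),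
      (forall T J, E (T, J) -> exists t : nat -> R,
         [/\ t 0%N = 0,
             (forall j, (j <= J)%N -> t j <= t j.+1) &
             E `&` (`[0, T]%classic `*` [set j | (j <= J)%N]) =
             \bigcup_(j in [set j | (j <= J)%N])
               (`[t j, t j.+1]%classic `*` [set j])]) &
      (forall p q, E p -> E q ->
         (p.1 <= q.1 /\ (p.2 <= q.2)%N) \/ (q.1 <= p.1 /\ (q.2 <= p.2)%N))].

(* A partial function R x nat -> R^n: the values outside the domain are
   irrelevant, and every notion below depends only on [hmap]. *)
Record hfun (R : realType) (n : nat) := HFun {
  hdom : set (R * nat);
  hval :> R -> nat -> 'rV[R]_n
}.

Definition hmap (R : realType) (n : nat) (x : hfun R n) :
    R * nat -> set 'rV[R]_n :=
  fun p => [set z | hdom x p /\ z = x p.1 p.2].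

Definition flow_interval (R : realType) (n : nat) (x : hfun R n) (j : nat) :
  set R := [set t | hdom x (t, j)].

Definition abs_continuous_on (R : realType) (n : nat) (a b : R)
    (f : R -> 'rV[R]_n) :=
  forall e : R, 0 < e -> exists2 d : R, 0 < d &
    forall (m : nat) (u v : 'I_m -> R),
      (forall k, a <= u k /\ u k <= v k /\ v k <= b) ->
      trivIset [set: 'I_m] (fun k => `]u k, v k[%classic) ->
      \sum_(k < m) (v k - u k) < d ->
      \sum_(k < m) enorm (f (v k) - f (u k)) < e.

Definition hybrid_arc (R : realType) (n : nat) (x : hfun R n) :=
  hybrid_time_domain (hdom x) /\
  forall (j : nat) (a b : R), `[a, b]%classic `<=` flow_interval x j ->
    abs_continuous_on a b (fun t => x t j).

(* The almost-everywhere clause only concerns interior points of the interval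
   up to a null set, where the derivative does not see junk values. *)
Definition solution (R : realType) (n : nat) (H : hybrid_data R n)
    (x : hfun R n) :=
  [/\ hybrid_arc x,
      hdom x (0, 0%N) /\ (closure (flow_set H) `|` jump_set H) (x 0 0%N),
      (forall j t, interior (flow_interval x j) t -> flow_set H (x t j)),
      (forall j, {ae (@lebesgue_measure R), forall t, flow_interval x j t ->
         exists2 v : 'rV[R]_n,
           is_derive (t : R^o) (1 : R^o) (fun s : R^o => x s j) v &
           flow_map H (x t j) v}) &
      (forall t j, hdom x (t, j) -> hdom x (t, j.+1) ->
         jump_set H (x t j) /\ jump_map H (x t j) (x t j.+1))].

Definition solution_from (R : realType) (n : nat) (H : hybrid_data R n)
    (x0 : 'rV[R]_n) (x : hfun R n) :=
  solution H x /\ x 0 0%N = x0.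

Definition maximal_solutions (R : realType) (n : nat) (H : hybrid_data R n)
    (x0 : 'rV[R]_n) : set (hfun R n) :=
  [set x | solution_from H x0 x /\
     forall y, solution H y -> sv_graph (hmap x) `<=` sv_graph (hmap y) ->
       hmap y = hmap x].

Definition complete_arc (R : realType) (n : nat) (x : hfun R n) :=
  ~ exists M : R, forall p, hdom x p -> p.1 + p.2%:R <= M.

Definition bounded_arc (R : realType) (n : nat) (x : hfun R n) :=
  exists M : R, forall p, hdom x p -> enorm (x p.1 p.2) <= M.

Definition escapes_at (R : realType) (n : nat) (x : hfun R n) (T : R)
    (J : nat) :=
  (\forall t \near T^'-, hdom x (t, J)) /\
  enorm (x t J) @[t --> T^'-] --> +oo.

Definition pre_forward_complete (R : realType) (n : nat)
    (H : hybrid_data R n) (x0 : 'rV[R]_n) :=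
  forall x, maximal_solutions H x0 x -> bounded_arc x \/ complete_arc x.

Definition reachable_set (R : realType) (n : nat) (H : hybrid_data R n)
    (x0 : 'rV[R]_n) (T : R) (J : nat) : set 'rV[R]_n :=
  [set z | exists x, [/\ maximal_solutions H x0 x, hdom x (T, J) & z = x T J]].

Definition jump_time (R : realType) (n : nat) (x : hfun R n) (t : R) :=
  exists j, hdom x (t, j) /\ hdom x (t, j.+1).

Definition terminal_hybrid_time (R : realType) (n : nat) (x : hfun R n)
    (h : R * nat) :=
  [/\ compact (hdom x), hdom x h &
      forall p, hdom x p -> p.1 <= h.1 /\ (p.2 <= h.2)%N].

Definition terminal_ordinary_time (R : realType) (n : nat) (x : hfun R n)
    (T : R) :=
  exists J, terminal_hybrid_time x (T, J).

Definition compact_solutions (R : realType) (n : nat) (H : hybrid_data R n) :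
  set (hfun R n) := [set x | solution H x /\ compact (hdom x)].

Definition locally_eventually_bounded (R : realType) (n : nat)
    (xs : nat -> hfun R n) :=
  forall tau : R, 0 <= tau -> exists (i0 : nat) (K : set 'rV[R]_n),
    compact K /\
    forall i, (i0 <= i)%N -> forall t j, hdom (xs i) (t, j) ->
      t + j%:R <= tau -> K (xs i t j).

Definition inner_limit (T : topologicalType) (E : nat -> set T) : set T :=
  [set p | forall V, nbhs p V ->
     exists i0, forall i, (i0 <= i)%N -> E i `&` V !=set0].

Definition outer_limit (T : topologicalType) (E : nat -> set T) : set T :=
  [set p | forall V, nbhs p V ->
     forall i0, exists i, (i0 <= i)%N /\ E i `&` V !=set0].

Definition pk_converges (T : topologicalType) (E : nat -> set T) (A : set T) :=
  inner_limit E = A /\ outer_limit E = A.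

Definition graphical_limit (R : realType) (n : nat) (xs : nat -> hfun R n)
    (N : R * nat -> set 'rV[R]_n) :=
  pk_converges (fun i => sv_graph (hmap (xs i))) (sv_graph N).

Definition close_arcs (R : realType) (n : nat) (tau e : R) (x y : hfun R n) :=
  let half (u v : hfun R n) :=
    forall t j, hdom u (t, j) -> t + j%:R <= tau ->
      exists2 s, hdom v (s, j) &
        `|t - s| < e /\ enorm (u t j - v s j) < e in
  half x y /\ half y x.

Definition perturbation (R : realType) (n : nat) (H : hybrid_data R n)
    (rho : 'rV[R]_n -> R) : hybrid_data R n :=
  HybridData
    [set x | cball x (rho x) `&` flow_set H !=set0]
    (fun x => [set z | exists v w,
       [/\ closure (conv_hull
             (sv_image (flow_map H) (cball x (rho x) `&` flow_set H))) v,
           cball 0 (rho x) w & z = v + w]])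
    [set x | cball x (rho x) `&` jump_set H !=set0]
    (fun x => [set z | exists2 y,
       sv_image (jump_map H) (cball x (rho x) `&` jump_set H) y &
       cball y (rho y) z]).

Definition before (R : realType) (T : R) (J : nat) : set (R * nat) :=
  `[0, T[%classic `*` [set j | (j <= J)%N].

Definition outer_well_posed (R : realType) (n : nat) (H : hybrid_data R n)
    (x0 : 'rV[R]_n) :=
  forall (rho : 'rV[R]_n -> R) (delta : nat -> R) (xs : nat -> hfun R n)
         (N : R * nat -> set 'rV[R]_n),
    (forall z, 0 <= rho z) -> continuous rho ->
    (forall i, 0 < delta i < 1) -> delta @ \oo --> (0 : R) ->
    graphical_limit xs N ->
    (forall i, solution (perturbation H (fun z => delta i * rho z)) (xs i)) ->
    (fun i => xs i 0 0%N) @ \oo --> x0 ->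
    (locally_eventually_bounded xs ->
       exists2 x, solution_from H x0 x & hmap x = N) /\
    (~ locally_eventually_bounded xs ->
       exists (T : R) (J : nat), 0 <= T /\
         exists x, [/\ hmap x = sv_restrict N (before T J),
                       solution_from H x0 x & escapes_at x T J]).

Definition nominally_inner_well_posed (R : realType) (n : nat)
    (H : hybrid_data R n) (x0 : 'rV[R]_n) :=
  forall x, solution_from H x0 x ->
  forall xi : nat -> 'rV[R]_n,
    (forall i, (closure (flow_set H) `|` jump_set H) (xi i)) ->
    xi @ \oo --> x 0 0%N ->
    exists xs : nat -> hfun R n,
      [/\ (forall i, solution_from H (xi i) (xs i)),
          (bounded_arc x \/ complete_arc x -> closed (hdom x) ->
             locally_eventually_bounded xs /\ graphical_limit xs (hmap x)) &
          (forall (T : R) (J : nat), 0 <= T -> escapes_at x T J ->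
             ~ locally_eventually_bounded xs /\
             exists2 N, graphical_limit xs N &
               hmap x = sv_restrict N (before T J))].

(* Data (x(0,0), (T,J), x(T,J)) on which costs and constraints depend. *)
Definition endpoint_data (R : realType) (n : nat) : Type :=
  ('rV[R]_n * (R * nat) * 'rV[R]_n)%type.

Definition endpoints (R : realType) (n : nat) (x : hfun R n) (h : R * nat) :
  endpoint_data R n := (x 0 0%N, h, x h.1 h.2).

(* Costs are functions on R^n x R_{>=0} x nat x R^n; they are represented by
   total functions, of which only the values at nonnegative times matter. *)
Definition cost_function (R : realType) (n : nat)
    (cost : endpoint_data R n -> R) :=
  forall p, 0 <= p.1.2.1 -> 0 <= cost p.

Definition cost_continuous_at (R : realType) (n : nat)
    (cost : 'rV[R]_n * (R * nat) * 'rV[R]_n -> R)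
    (p : 'rV[R]_n * (R * nat) * 'rV[R]_n) :=
  cost @ within [set q | 0 <= q.1.2.1] (nbhs p) --> cost p.

Definition feasible_at (R : realType) (n : nat) (H : hybrid_data R n)
    (Omega : set (endpoint_data R n)) (x : hfun R n) (h : R * nat) :=
  [/\ compact_solutions H x, terminal_hybrid_time x h & Omega (endpoints x h)].

Definition optimal (R : realType) (n : nat) (H : hybrid_data R n)
    (Omega : set (endpoint_data R n)) (cost : endpoint_data R n -> R) :
    set (hfun R n) :=
  [set x | exists2 h, feasible_at H Omega x h &
     cost (endpoints x h) =
     inf [set c | exists y k,
            feasible_at H Omega y k /\ c = cost (endpoints y k)]].

Definition optimal_solutions (R : realType) (n : nat) (H : hybrid_data R n)
    (cost : endpoint_data R n -> R) (x0 : 'rV[R]_n) (T : R) (J : nat) :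
    set (hfun R n) :=
  optimal H ([set x0] `*` [set (T, J)] `*` [set: 'rV[R]_n]) cost.

(* Main.v *)
Require Import Defs.
From HB Require Import structures.
From mathcomp Require Import all_boot all_order all_algebra.
From mathcomp Require Import all_classical all_reals all_analysis.
From mathcomp Require Import lra.

Set Implicit Arguments.
Unset Strict Implicit.
Unset Printing Implicit Defensive.

Import Order.TTheory GRing.Theory Num.Theory.
Import numFieldNormedType.Exports.

Local Open Scope classical_set_scope.
Local Open Scope ring_scope.

(** The theorem is the classical argument that minimizers depend upper
    semicontinuously on a parameter: limits of minimizers are feasible, and
    every feasible competitor at the limit parameter is approximated by
    feasible competitors at nearby parameters, so that the cost inequality
    passes to the limit.  Both halves are supplied by well-posedness.

    Compactness.  Let [xs] be solutions of H whose initial points tend to x0.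
    A subsequence converges graphically, because sets in a space with a
    countable base are sequentially compact for Painleve-Kuratowski convergence
    ([graphical_subsequence]).  Outer well-posedness, used with the zero
    perturbation, leaves two cases: either the sequence is locally eventually
    bounded and its limit is a solution from x0, or a solution from x0 escapes
    to infinity.  An escaping solution admits no proper extension, is unbounded
    and has a bounded domain, so pre-forward completeness excludes the second
    case ([no_escape], [well_posed_limit]).

    Feasibility of the limit.  Local eventual boundedness turns graphical
    convergence into convergence of values along convergent hybrid times
    ([leb_value_cvg]).  Applied to terminal times, it shows that the limit ends
    at (T, J) and that the terminal values converge.

    Competitors.  A feasible y for the data (x0, (T, J)) extends to a maximal
    solution by Zorn's lemma ([exists_maximal_extension]), so y(T, J) is
    reachable; the regularity hypothesis replaces that extension by a maximal
    solution w with w(T, J) = y(T, J) for which T is neither a jump time nor the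
    terminal time.  Hence T is interior, relative to nonnegative times, to the
    flow interval of w with index J ([regular_time_interior]).  The domain of w is closed: the closure of its
    graph is the graphical limit of the constant sequence w, hence a solution
    extending w, which is w itself by maximality ([maximal_solution_closed]).
    Inner well-posedness therefore yields solutions from the perturbed initial
    points converging to w; by interiority they are defined at the perturbed
    terminal times and can be truncated there ([exists_competitors]).

    These facts give outer semicontinuity ([optimal_graphical_limit]).  Local
    boundedness and upper semicontinuity follow by contradiction, extracting a
    graphically convergent subsequence from a sequence of counterexamples; for
    the latter, local eventual boundedness upgrades graphical convergence to
    (tau, e)-closeness ([leb_close]). *)

(** * Hybrid time domains *)

(** Normal form of the truncation at a point (T, J) of the domain: the last
    node of the defining sequence may be taken to be T itself, because (T, J)
    belongs to the truncation and bounds it. *)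
Lemma time_domain_grid (R : realType) (E : set (R * nat)) (T : R) (J : nat) :
  hybrid_time_domain E -> E (T, J) ->
  exists t : nat -> R,
    [/\ t 0%N = 0, (forall j, (j <= J)%N -> t j <= t j.+1), t J.+1 = T &
        forall s j, (j <= J)%N -> (E (s, j) /\ s <= T) <-> t j <= s <= t j.+1].
Proof.
move=> [E0 trE _] ETJ; have [t [t0 tle Et]] := trE _ _ ETJ.
have Ht s j : (j <= J)%N -> (E (s, j) /\ s <= T) <-> t j <= s <= t j.+1.
  move=> jJ; split.
    move=> [Esj sT].
    have : (E `&` (`[0, T]%classic `*` [set j | (j <= J)%N])) (s, j).
      split=> //; split=> //=; rewrite in_itv /= sT andbT; exact: (E0 _ Esj).
    by rewrite Et => -[k kJ [/= +]] jk; rewrite -jk in_itv.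
  move=> sj.
  have : (\bigcup_(j in [set j | (j <= J)%N])
               (`[t j, t j.+1]%classic `*` [set j])) (s, j).
    by exists j => //; split=> //=; rewrite in_itv.
  by rewrite -Et => -[? [/= + _]]; rewrite in_itv /= => /andP[].
exists t; split=> //.
have /andP[_ Tle] : t J <= T <= t J.+1 by apply/Ht.
apply/le_anti; rewrite Tle andbT.
have [_ //] : E (t J.+1, J) /\ t J.+1 <= T.
by apply/Ht; rewrite // lexx tle.
Qed.

(** A hybrid time domain extends another one only beyond its end: the jump
    times of the two truncations at a common point are determined one after the
    other, each being the end of the previous flow interval. *)
Lemma time_domain_down_closed (R : realType) (E E' : set (R * nat)) T J s j :
  hybrid_time_domain E -> hybrid_time_domain E' -> E `<=` E' ->
  E (T, J) -> E' (s, j) -> s <= T -> (j <= J)%N -> E (s, j).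
Proof.
move=> hE hE' sEE' ETJ E'sj sT jJ.
have [t [t0 tle tT Et]] := time_domain_grid hE ETJ.
have [t' [t'0 t'le t'T Et']] := time_domain_grid hE' (sEE' _ ETJ).
have sub i : (i <= J)%N -> t' i <= t i /\ t i.+1 <= t' i.+1.
  move=> iJ.
  have sub1 r : t i <= r <= t i.+1 -> t' i <= r <= t' i.+1.
    by move=> /(Et r i iJ)[? ?]; apply/Et' => //; split=> //; exact: sEE'.
  have /andP[-> _] := sub1 (t i) ltac:(by rewrite lexx tle).
  by have /andP[_ ->] := sub1 (t i.+1) ltac:(by rewrite lexx tle).
(* Each node is both the end of one interval and the start of the next;
   inclusion of the intervals bounds it from both sides. *)
have eqt i : (i <= J.+1)%N -> t i = t' i.
  case: i => [_|i]; first by rewrite t0 t'0.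
  rewrite ltnS => iJ; apply/le_anti; rewrite (sub i iJ).2 /=.
  move: iJ; rewrite leq_eqVlt => /orP[/eqP->|iJ]; first by rewrite tT t'T.
  exact: (sub i.+1 iJ).1.
apply: (proj2 (Et s j jJ) _).1.
rewrite !eqt ?ltnS// 1?ltnW ?ltnS//.
by apply/Et'.
Qed.

Lemma flow_interval_convex (R : realType) (E : set (R * nat)) a b s j :
  hybrid_time_domain E -> E (a, j) -> E (b, j) -> a <= s <= b -> E (s, j).
Proof.
move=> hE Ea Eb /andP[as_ sb].
have [t [_ _ _ Et]] := time_domain_grid hE Eb.
have /andP[ta _] : t j <= a <= t j.+1.
  by apply/Et => //; split=> //; exact: le_trans sb.
have /andP[_ tb] : t j <= b <= t j.+1 by apply/Et.
apply: (proj2 (Et s j (leqnn j)) _).1.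
by rewrite (le_trans ta) //= (le_trans sb).
Qed.

Lemma exists_jump_after (R : realType) (E : set (R * nat)) s s' j j' :
  hybrid_time_domain E -> E (s, j) -> E (s', j') -> (j < j')%N ->
  exists r, [/\ s <= r, r <= s', E (r, j) & E (r, j.+1)].
Proof.
move=> hE Es Es' jj'.
have ss' : s <= s'.
  have [_ _ cmp] := hE.
  have [/=[]//|/=[_]] := cmp _ _ Es Es'.
  by rewrite leqNgt jj'.
have [t [_ tle _ Et]] := time_domain_grid hE Es'.
have jJ := ltnW jj'.
have /andP[_ sr] : t j <= s <= t j.+1 by apply/Et.
have [Er r_s'] : E (t j.+1, j) /\ t j.+1 <= s'.
  by apply/Et => //; rewrite lexx tle.
exists (t j.+1); split=> //.
by apply: (proj2 (Et (t j.+1) j.+1 jj') _).1; rewrite lexx tle.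
Qed.

(** A domain is right-open at (T, J) only if it ends there: the truncation
    at any later point has closed slices. *)
Lemma time_domain_closed_left (R : realType) (E : set (R * nat)) T J u j d :
  hybrid_time_domain E -> E (u, j) -> T <= u -> (J <= j)%N -> 0 < d ->
  (forall s, T - d < s < T -> E (s, J)) -> E (T, J).
Proof.
move=> hE Euj Tu Jj d0 Es.
have [t [_ _ _ Et]] := time_domain_grid hE Euj.
have tb s : T - d < s < T -> t J <= s <= t J.+1.
  move=> sT; apply/Et => //; split; first exact: Es.
  by case/andP: sT => _ /ltW/le_trans; apply.
have /andP[h1 h2] := tb (T - d / 2) ltac:(apply/andP; split; lra).
apply: (proj2 (Et T J Jj) _).1; apply/andP; split; first lra.
rewrite leNgt; apply/negP => h.
have := tb ((t J.+1 + T) / 2) ltac:(apply/andP; split; lra).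
by move=> /andP[_]; lra.
Qed.

Definition past (R : realType) (T : R) (J : nat) : set (R * nat) :=
  [set p | p.1 <= T /\ (p.2 <= J)%N].

Lemma time_domain_truncation (R : realType) (E : set (R * nat)) T J :
  hybrid_time_domain E -> hybrid_time_domain (E `&` past T J).
Proof.
move=> [E0 trE cmp]; split=> [p [/E0//]| S K [ESK [/= ST KJ]]|p q [Ep _] [Eq _]].
- have [t [t0 tle tE]] := trE _ _ ESK.
  exists t; split=> //; rewrite -tE; apply/seteqP; split=> [[s j]|[s j]] /=.
    by move=> [[? _] ?].
  move=> [Es [+ jK]]. rewrite in_itv /= => /andP[s0 sS]; split.
    by split=> //; split=> //=; [exact: le_trans ST|exact: leq_trans KJ].
  by split=> //=; apply/andP.
- exact: cmp.
Qed.

(** Truncating at a point of the domain leaves finitely many compact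
    segments. *)
Lemma truncation_compact (R : realType) (E : set (R * nat)) T J :
  hybrid_time_domain E -> E (T, J) -> compact (E `&` past T J).
Proof.
move=> hE ETJ; have [t [t0 tle tT Et]] := time_domain_grid hE ETJ.
have -> : E `&` past T J =
    \bigcup_(j in `I_J.+1) (`[t j, t j.+1]%classic `*` [set j]).
  apply/seteqP; split=> [[s j] [Es [/= sT jJ]]|[s j] [k /= kJ [/= + ->]]].
    by exists j => //; split=> //=; rewrite in_itv /=; apply/Et.
  by rewrite in_itv /= => /(Et s k kJ)[].
rewrite (bigcup_mkord _ (fun j => `[t j, t j.+1]%classic `*` [set j])).
apply: bigsetU_compact => j _; apply: compact_setX; first exact: segment_compact.
exact: compact_set1.
Qed.

(** * Perturbation and truncation of solutions *)

(** Flow intervals are convex, so only their two endpoints can fail to be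
    interior points.  This reconciles the flow-set condition, which holds in the
    interior, with the differential inclusion, which holds almost everywhere. *)
Lemma ae_interior_flow_interval (R : realType) (E : set (R * nat)) (j : nat) :
  hybrid_time_domain E ->
  {ae (@lebesgue_measure R), forall t, E (t, j) ->
     interior [set s | E (s, j)] t}.
Proof.
move=> hE; set I := [set s | E (s, j)].
have : (@lebesgue_measure R).-negligible [set inf I; sup I].
  by apply: negligibleU; apply/negligibleP => //; exact: lebesgue_measure_set1.
apply: negligibleS.
move=> t /= /not_implyP[It nint].
have [[a Ia at_]|noa] := pselect (exists2 a, I a & a < t); last first.
  left; have lbt : lbound I t.
    by move=> a Ia; rewrite leNgt; apply/negP => at_; apply: noa; exists a.
  apply/le_anti/andP; split; last by apply: ge_inf => //; exists t.
  by apply: lb_le_inf => //; exists t.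
have [[b Ib tb]|nob] := pselect (exists2 b, I b & t < b); last first.
  right; have ubt : ubound I t.
    by move=> b Ib; rewrite leNgt; apply/negP => tb; apply: nob; exists b.
  apply/le_anti/andP; split; first by apply: ub_le_sup => //; exists t.
  by apply: ge_sup => //; exists t.
exfalso; apply: nint.
have tab : t \in `]a, b[ by rewrite in_itv /= at_.
apply: filterS (near_in_itvoo tab) => s; rewrite in_itv /= => /andP[as_ sb].
by apply: (flow_interval_convex hE Ia Ib); rewrite !ltW.
Qed.

Lemma enorm0 (R : realType) (n : nat) : enorm (0 : 'rV[R]_n) = 0.
Proof.
by rewrite /enorm big1 ?sqrtr0// => i _; rewrite mxE expr0n.
Qed.

Lemma cball_refl (R : realType) (n : nat) (x : 'rV[R]_n) (r : R) :
  0 <= r -> cball x r x.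
Proof. by move=> r0; rewrite /cball /= subrr enorm0. Qed.

(** Lets outer well-posedness, a statement about perturbed systems, be
    applied to solutions of the nominal system. *)
Lemma solution_perturbation (R : realType) (n : nat) (H : hybrid_data R n)
    (rho : 'rV[R]_n -> R) (x : hfun R n) :
  (forall z, 0 <= rho z) -> solution H x -> solution (perturbation H rho) x.
Proof.
move=> rho0 [[hE ac] [d0 i0] fl aefl jmp].
have subC : flow_set H `<=` flow_set (perturbation H rho).
  by move=> z Cz; exists z; split=> //; apply: cball_refl.
have subD : jump_set H `<=` jump_set (perturbation H rho).
  by move=> z Cz; exists z; split=> //; apply: cball_refl.
split=> //.
- split=> //; case: i0 => [/(closureS subC)|/subD]; first by left.
  by right.
- by move=> j t /fl/subC.
- move=> j; have := aefl j; have := ae_interior_flow_interval j hE.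
  apply: (filterS2 (ae_filter_ringOfSetsType (@lebesgue_measure R))).
  move=> t tint ae xt.
  have [v dv Fv] := ae xt.
  exists v => //; exists v, 0; split; last by rewrite addr0.
    apply: subset_closure => A [_ sA]; apply: sA.
    exists (x t j) => //; split; first exact: cball_refl.
    by apply: fl; exact: tint.
  exact: cball_refl.
- move=> t j h1 h2; have [Dx Gx] := jmp t j h1 h2; split; first exact: subD.
  exists (x t j.+1); last exact: cball_refl.
  by exists (x t j) => //; split=> //; exact: cball_refl.
Qed.

Definition truncate (R : realType) (n : nat) (x : hfun R n) (T : R) (J : nat) :
  hfun R n := HFun (hdom x `&` past T J) (hval x).

Lemma solution_truncate (R : realType) (n : nat) (H : hybrid_data R n)
    (x : hfun R n) (T : R) (J : nat) :
  0 <= T -> solution H x -> solution H (truncate x T J).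
Proof.
move=> T0 [[hE ac] [d0 i0] fl aefl jmp]; split.
- split; first exact: time_domain_truncation.
  by move=> j a b ab; apply: ac => t /ab[].
- by split=> //; split.
- move=> j t it; apply: fl; apply: interiorS it => s [].
  by [].
- move=> j; have := aefl j.
  apply: (@filterS _ _ (ae_filter_ringOfSetsType (@lebesgue_measure R))).
  by move=> t + [xt _]; apply.
- by move=> t j [? _] [? _]; exact: jmp.
Qed.

Lemma truncate_terminal (R : realType) (n : nat) (H : hybrid_data R n)
    (x : hfun R n) (T : R) (J : nat) :
  solution H x -> hdom x (T, J) ->
  terminal_hybrid_time (truncate x T J) (T, J).
Proof.
move=> [[hE _] _ _ _ _] xTJ; split.
- exact: truncation_compact.
- by split.
- by move=> p [_].
Qed.

(** * Escaping solutions are excluded by pre-forward completeness *)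

(** Inclusion of graphs, the relation in terms of which maximality of
    solutions is defined. *)
Definition extends (R : realType) (n : nat) (x y : hfun R n) : Prop :=
  sv_graph (hmap x) `<=` sv_graph (hmap y).

Lemma extendsP (R : realType) (n : nat) (x y : hfun R n) :
  extends x y <->
  forall t j, hdom x (t, j) -> hdom y (t, j) /\ x t j = y t j.
Proof.
split=> [xy t j xtj|xy [[t j] z] [/= xtj ->]].
  exact: (xy ((t, j), x t j) (conj xtj erefl)).
by have [ytj eq] := xy _ _ xtj; split.
Qed.

Lemma extends_anti (R : realType) (n : nat) (x y : hfun R n) :
  extends x y -> extends y x -> hmap x = hmap y.
Proof.
move=> xy yx; apply/funext => p; apply/seteqP; split=> z h.
  exact: (xy (p, z) h).
exact: (yx (p, z) h).
Qed.

Lemma coord_le_enorm (R : realType) (n : nat) (v : 'rV[R]_n) i :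
  `|v ord0 i| <= enorm v.
Proof.
rewrite -sqrtr_sqr /enorm ler_sqrt; last by apply: sumr_ge0 => k _; apply: sqr_ge0.
by rewrite (bigD1 i) //= lerDl; apply: sumr_ge0 => k _; apply: sqr_ge0.
Qed.

(** Absolute continuity up to a time T in the domain prevents escape at T. *)
Lemma arc_bounded_left (R : realType) (n : nat) (y : hfun R n) a T J :
  hybrid_arc y -> hdom y (a, J) -> hdom y (T, J) -> a < T ->
  exists M, \forall t \near T^'-, enorm (y t J) <= M.
Proof.
move=> [hE ac] ya yT aT.
have iaT : `[a, T]%classic `<=` flow_interval y J.
  by move=> s; rewrite /= in_itv /=; exact: flow_interval_convex.
have [d d0 dy] := ac _ _ _ iaT 1 ltr01.
exists (Num.sqrt (\sum_i (`|y T J ord0 i| + 1) ^+ 2)).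
near=> t.
have tT : t < T by near: t; exact: nbhs_left_lt.
have at_ : a <= t by apply: ltW; near: t; exact: nbhs_left_gt.
have Ttd : T - t < d.
  suff : T - d < t by lra.
  by near: t; apply: nbhs_left_gt; lra.
have := dy 1%N (fun=> t) (fun=> T); rewrite !big_ord1 => /(_ _ _ Ttd).
move=> /(_ (fun=> conj at_ (conj (ltW tT) (lexx T)))) => /(_ _)/ltW close.
rewrite /enorm ler_sqrt; last by apply: sumr_ge0 => k _; apply: sqr_ge0.
apply: ler_sum => i _; rewrite -real_normK ?num_real//.
rewrite lerXn2r ?nnegrE ?addr_ge0//.
have le1 : `|(y T J - y t J) ord0 i| <= 1.
  apply: le_trans (coord_le_enorm _ _) (close _) => j k _ _ _.
  by rewrite !ord1.
move: le1; rewrite !mxE => le1.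
rewrite -[X in `|X|](subKr (y T J ord0 i)).
by rewrite (le_trans (ler_normB _ _))// lerD2l.
Unshelve. all: by end_near. Qed.

(** No arc continues past an escape time: if [y] had a point at or beyond
    (T, J), then (T, J) would lie in its domain, where [y] is locally bounded. *)
Lemma escape_cofinal (R : realType) (n : nat) (x y : hfun R n) T J u j :
  hybrid_arc y -> extends x y -> escapes_at x T J -> hdom y (u, j) ->
  exists s, [/\ s < T, hdom x (s, J), u <= s & (j <= J)%N].
Proof.
move=> hy /extendsP xy [xnear xoo] yuj.
have [d /= d0 xd] := xnear.
have {}xd s : T - d < s < T -> hdom x (s, J).
  move=> /andP[ds sT]; apply: xd => //=.
  by rewrite ger0_norm; lra.
apply: contrapT => nex.
have cmp s : T - d < s < T -> s <= u /\ (J <= j)%N.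
  move=> sT; have [ys _] := xy _ _ (xd _ sT).
  have [_ _ /(_ _ _ yuj ys)[/=[us jJ]|//]] := hy.1.
  exfalso; apply: nex; exists s; split=> //; last exact: xd.
  by case/andP: sT.
have Jj : (J <= j)%N by apply: (cmp (T - d / 2) _).2; apply/andP; split; lra.
have Tu : T <= u.
  rewrite leNgt; apply/negP => uT.
  have mT : T - d < Num.max ((u + T) / 2) (T - d / 2) < T.
    by rewrite lt_max gt_max; apply/andP; split; [apply/orP; right|apply/andP; split]; lra.
  have [le_u _] := cmp _ mT.
  by move: le_u; rewrite ge_max => /andP[+ _]; lra.
have yT : hdom y (T, J).
  apply: (time_domain_closed_left hy.1 yuj Tu Jj d0) => s sT.
  by have [] := xy _ _ (xd _ sT).
have yd : hdom y (T - d / 2, J).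
  by have [] // := xy (T - d / 2) J; apply: xd; apply/andP; split; lra.
have [|M yM] := arc_bounded_left hy yd yT; first lra.
have [t [/= yt xt txd]] : exists t, [/\ enorm (y t J) <= M, M < enorm (x t J) &
    hdom x (t, J)].
  apply: (@filter_ex _ (T^'-)).
  near=> t; split; [near: t; exact: yM| |near: t; exact: xnear].
  by near: t; move/cvgryPgt : xoo; apply.
by have [_ eqxy] := xy _ _ txd; move: xt; rewrite eqxy ltNge yt.
Unshelve. all: by end_near. Qed.

(** An escaping solution is maximal by [escape_cofinal], yet neither bounded
    nor complete. *)
Lemma no_escape (R : realType) (n : nat) (H : hybrid_data R n) x0 x T J :
  pre_forward_complete H x0 -> solution_from H x0 x -> ~ escapes_at x T J.
Proof.
move=> pfc [solx x00] esc.
have hx : hybrid_arc x by case: solx.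
have ext_refl : extends x x by [].
have maxx : maximal_solutions H x0 x.
  split=> // y soly xy.
  have hy : hybrid_arc y by case: soly.
  suff yx : extends y x by exact: extends_anti.
  apply/extendsP => u j yuj.
  have [s [sT xs us jJ]] := escape_cofinal hy xy esc yuj.
  have xuj : hdom x (u, j).
    apply: (time_domain_down_closed hx.1 hy.1 _ xs yuj us jJ).
    by move=> [t k] xtk; have [] := (extendsP x y).1 xy _ _ xtk.
  by split=> //; have [_ ->] := (extendsP x y).1 xy _ _ xuj.
have [[M xM]|] := pfc _ maxx.
  have [t [/= txd]] : exists t, hdom x (t, J) /\ M < enorm (x t J).
    apply: (@filter_ex _ (T^'-)).
    near=> t; split; first by near: t; exact: esc.1.
    by near: t; move/cvgryPgt : esc.2; apply.
  by rewrite ltNge (xM _ txd).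
apply; exists (T + J%:R) => -[u j] xuj /=.
have [s [sT _ us jJ]] := escape_cofinal hx ext_refl esc xuj.
by rewrite lerD ?ler_nat// (le_trans us)// ltW.
Unshelve. all: by end_near. Qed.

(** * Extension to maximal solutions *)

(** The values of the members of a chain agree wherever several are defined,
    so any choice of value at a point gives the union of the graphs. *)
Definition chain_union (R : realType) (n : nat) (A : set (hfun R n)) :
  hfun R n :=
  HFun (\bigcup_(a in A) hdom a)
       (fun t j => xget 0 [set z | exists2 a, A a & hmap a (t, j) z]).

Lemma extends_chain_union (R : realType) (n : nat) (A : set (hfun R n)) a :
  total_on A (@extends R n) -> A a -> extends a (chain_union A).
Proof.
move=> totA Aa; apply/extendsP => t j atj; split; first by exists a.
set P := [set z | exists2 a, A a & hmap a (t, j) z].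
have [b Ab [/= btj ->]] : P (xget 0 P).
  by apply: (xgetPex 0); exists (a t j); exists a.
by have [/extendsP/(_ _ _ atj)[]|/extendsP/(_ _ _ btj)[]] := totA _ _ Aa Ab.
Qed.

(** A member of the chain already contains everything in the union that lies
    before one of its points, so that every property of the union that concerns
    bounded pieces of the domain is inherited from a single member. *)
Lemma chain_union_past (R : realType) (n : nat) (A : set (hfun R n)) a T J :
  total_on A (@extends R n) ->
  (forall b, A b -> hybrid_time_domain (hdom b)) ->
  A a -> hdom a (T, J) ->
  forall s j, hdom (chain_union A) (s, j) -> s <= T -> (j <= J)%N ->
  hdom a (s, j).
Proof.
move=> totA htdA Aa aTJ s j [b Ab bsj] sT jJ.
have [/extendsP ab|/extendsP/(_ _ _ bsj)[]//] := totA _ _ Aa Ab.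
apply: (time_domain_down_closed (htdA _ Aa) (htdA _ Ab) _ aTJ bsj sT jJ).
by move=> [u k] /ab[].
Qed.

Lemma chain_union_time_domain (R : realType) (n : nat) (A : set (hfun R n)) :
  total_on A (@extends R n) ->
  (forall b, A b -> hybrid_time_domain (hdom b)) ->
  hybrid_time_domain (hdom (chain_union A)).
Proof.
move=> totA htdA; split=> [p [a /htdA[a0 _ _] /a0]//|T J [a Aa aTJ]|p q].
- have [_ /(_ _ _ aTJ)[t [t0 tle tE]] _] := htdA _ Aa.
  exists t; split=> //; rewrite -tE; apply/seteqP; split=> -[s j] [h [+ jJ]].
    rewrite /= in_itv /= => /andP[s0 sT]; split; last first.
      by split=> //=; rewrite s0.
    exact: (chain_union_past totA htdA Aa aTJ h sT jJ).
  by move=> sT; split=> //; exists a.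
- move=> [a Aa ap] [b Ab bq].
  have [ab|ba] := totA _ _ Aa Ab.
    have [_ _] := htdA _ Ab; apply => //.
    by move/extendsP : ab; case: p ap => t j /[swap]/[apply] -[].
  have [_ _] := htdA _ Aa; apply => //.
  by move/extendsP : ba; case: q bq => t j /[swap]/[apply] -[].
Qed.

Lemma abs_continuous_on_ext (R : realType) (n : nat) (a b : R)
    (f g : R -> 'rV[R]_n) :
  (forall t, a <= t <= b -> f t = g t) ->
  abs_continuous_on a b f -> abs_continuous_on a b g.
Proof.
move=> fg acf e e0; have [d d0 fd] := acf _ e0; exists d => // m u v uv tr sm.
rewrite (eq_bigr (fun k => enorm (f (v k) - f (u k)))); first exact: fd.
move=> k _; have [au [uv_ vb]] := uv k.
by rewrite !fg// ?au ?vb ?andbT//= ?(le_trans au)// (le_trans uv_).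
Qed.

(** The chain may be uncountable, so the exceptional null sets of its members
    cannot be collected directly.  Countably many members suffice: one for each
    rational time of the flow interval, since an interior time t is followed by a
    rational time q of that interval and a member defined at (q, j) coincides
    with the union near t. *)
Lemma chain_union_solution (R : realType) (n : nat) (H : hybrid_data R n)
    (A : set (hfun R n)) :
  total_on A (@extends R n) -> A !=set0 -> (forall a, A a -> solution H a) ->
  solution H (chain_union A).
Proof.
move=> totA [a0 Aa0] solA; set x := chain_union A.
have htdA b : A b -> hybrid_time_domain (hdom b) by move=> /solA[[]].
have hE : hybrid_time_domain (hdom x) by exact: chain_union_time_domain.
have extA a : A a -> forall t j, hdom a (t, j) -> hdom x (t, j) /\ a t j = x t j.
  by move=> Aa; apply/extendsP; exact: extends_chain_union.
have nearA j t : interior (flow_interval x j) t ->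
    exists2 r : R, t < r & hdom x (r, j) /\ (forall a q, A a -> t < q <= r ->
      hdom a (q, j) -> interior (flow_interval a j) t).
  move=> /nbhs_ballP[e /= e0 et].
  exists (t + e / 2); first lra.
  split; first by apply: et; rewrite /ball /= ltr_norml; apply/andP; split; lra.
  move=> a q Aa /andP[tq qr] aq; apply/nbhs_ballP; exists (Num.min e (q - t)).
    by rewrite /= lt_min e0 subr_gt0.
  move=> s; rewrite /ball /= lt_min => /andP[se sq].
  have sq' : s <= q by move: sq; rewrite ltr_norml => /andP[]; lra.
  by apply: (chain_union_past totA htdA Aa aq _ sq' (leqnn j)); exact: et.
split.
- split=> // j a b ab.
  (* An empty segment lies in every member. *)
  have [c Ac cab] : exists2 c, A c & `[a, b]%classic `<=` flow_interval c j.
    have [ab_|ba] := leP a b; last first.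
      exists a0 => // s; rewrite /= in_itv /= => /andP[/le_trans]/[apply].
      by rewrite leNgt ba.
    have [|c Ac cb] := ab b; first by rewrite /= in_itv /= lexx ab_.
    exists c => // s sab.
    have sb : s <= b by move: sab; rewrite /= in_itv /= => /andP[].
    exact: (chain_union_past totA htdA Ac cb (ab _ sab) sb (leqnn j)).
  apply: (@abs_continuous_on_ext _ _ _ _ (fun t => c t j)).
    by move=> t tab; apply: (extA _ Ac _ _ _).2; apply: cab; rewrite /= in_itv.
  by have [[_ acc] _ _ _ _] := solA _ Ac; exact: acc.
- have [_ [a00 ia0] _ _ _] := solA _ Aa0.
  by have [x00 <-] := extA _ Aa0 _ _ a00.
- move=> j t /nearA[r tr [[a Aa ar]]] /(_ a r Aa) int_a.
  have {}int_a : interior (flow_interval a j) t by apply: int_a; rewrite ?tr ?lexx.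
  have [_ _ fla _ _] := solA _ Aa.
  have [_ <-] := extA _ Aa t j (interior_subset int_a).
  exact: fla.
- move=> j.
  (* The rational cut times, enumerated by [nat]; 0 fills the unused codes. *)
  pose cut (k : nat) : R := ratr (odflt 0 (unpickle k : option rat)).
  have [c cP] : exists c : nat -> hfun R n, forall k,
      A (c k) /\ (hdom x (cut k, j) -> hdom (c k) (cut k, j)).
    have : forall k, exists c : hfun R n,
        A c /\ (hdom x (cut k, j) -> hdom c (cut k, j)).
      move=> k; have [[c Ac ck]|nx] := pselect (hdom x (cut k, j)).
        by exists c.
      by exists a0.
    by move=> /choice[c cP]; exists c.
  have aec : {ae (@lebesgue_measure R), forall t, forall k, flow_interval (c k) j t ->
       exists2 v : 'rV[R]_n,
           is_derive (t : R^o) (1 : R^o) (fun s : R^o => c k s j) v &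
           flow_map H (c k t j) v}.
    apply: ae_foralln => k.
    by have [_ _ _ + _] := solA _ (cP k).1; apply.
  have aei := ae_interior_flow_interval j hE.
  move: aei aec; apply: (filterS2 (ae_filter_ringOfSetsType (@lebesgue_measure R))).
  move=> t ti tc xt.
  have [r tr [xr]] := nearA j t (ti xt).
  have [q] := rat_in_itvoo tr; rewrite in_itv /= => /andP[tq qr].
  have xq : hdom x (ratr q, j).
    by apply: (flow_interval_convex hE xt xr); rewrite !ltW.
  have [Ac] := cP (pickle q); rewrite /cut pickleK /= => /(_ xq) cq.
  move=> /(_ _ _ Ac _ cq); rewrite tq ltW// => /(_ isT) intc.
  have ct := interior_subset intc.
  have [v dv Fv] := tc _ ct.
  exists v; last by move: Fv; rewrite (extA _ Ac _ _ ct).2.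
  apply: (near_eq_is_derive _ dv).
  apply: filterS intc => s cs; exact: (extA _ Ac _ _ cs).2.
- move=> t j [a Aa at_] [b Ab bt].
  have sol c : A c -> hdom c (t, j) -> hdom c (t, j.+1) ->
      jump_set H (x t j) /\ jump_map H (x t j) (x t j.+1).
    move=> Ac c1 c2; have [_ _ _ _ jmp] := solA _ Ac.
    by rewrite -(extA _ Ac _ _ c1).2 -(extA _ Ac _ _ c2).2; exact: jmp.
  have [/extendsP ab|/extendsP ba] := totA _ _ Aa Ab.
    by apply: (sol b) => //; exact: (ab _ _ at_).1.
  by apply: (sol a) => //; exact: (ba _ _ bt).1.
Qed.

Lemma extends_trans (R : realType) (n : nat) (x y z : hfun R n) :
  extends x y -> extends y z -> extends x z.
Proof. exact: subset_trans. Qed.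

(** Zorn's lemma for the solutions extending [x], preordered by extension:
    an upper bound of a chain is its union. *)
Lemma exists_maximal_extension (R : realType) (n : nat) (H : hybrid_data R n)
    (x : hfun R n) :
  solution H x ->
  exists2 y, maximal_solutions H (x 0 0%N) y & extends x y.
Proof.
move=> solx.
pose U := {y : hfun R n | solution H y /\ extends x y}.
pose x' : U := exist _ x (conj solx (fun _ => id)).
pose le (u v : U) := `[< extends (sval u) (sval v) >].
have [||B totB|[y [soly xy]] maxy] := @ZL_preorder U x' le.
- by move=> u; apply/asboolP.
- by move=> u v w /asboolP uv /asboolP vw; apply/asboolP; exact: extends_trans vw.
- have [[b Bb]|B0] := pselect (B !=set0); last first.
    by exists x' => s Bs; exfalso; apply: B0; exists s.
  pose A := [set sval b | b in B].
  have totA : total_on A (@extends R n).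
    move=> _ _ [u Bu <-] [v Bv <-].
    by have [/asboolP|/asboolP] := totB _ _ Bu Bv; [left|right].
  have solA : solution H (chain_union A).
    apply: chain_union_solution => //; first by exists (sval b); exists b.
    by move=> _ [u _ <-]; exact: (svalP u).1.
  have extA u : B u -> extends (sval u) (chain_union A).
    by move=> Bu; apply: extends_chain_union => //; exists u.
  exists (exist _ (chain_union A) (conj solA (extends_trans (svalP b).2 (extA _ Bb)))).
  by move=> u Bu; apply/asboolP; exact: extA.
exists y => //; split.
  split=> //; have [_ [x00 _] _ _ _] := solx.
  by have [_ ->] := (extendsP x y).1 xy _ _ x00.
move=> z solz yz; apply: extends_anti => //.
have xz := extends_trans xy yz.
have := maxy (exist _ z (conj solz xz)).
by rewrite /le /= => /(_ (asboolT yz))/asboolP.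
Qed.

(** * Sequential compactness for graphical convergence *)

(** An ultrafilter G finer than the cofinite filter decides, for each basic
    set U k, whether the sets E i meet it.  For each m the set of indices that
    agree with the verdicts of G on the first m basic sets belongs to G, hence is
    infinite, so one can pick an increasing sequence of such indices.  Along it
    each basic set is met eventually always or eventually never, which is what
    makes the outer limit equal to the inner one. *)
Lemma pk_subsequence (T : topologicalType) (I : countType) (U : I -> set T)
    (E : nat -> set T) :
  (forall (p : T) (V : set T), nbhs p V -> exists k, nbhs p (U k) /\ U k `<=` V) ->
  exists phi : nat -> nat, (forall i, (phi i < phi i.+1)%N) /\
    exists A, pk_converges (fun i => E (phi i)) A.
Proof.
move=> baseU.
have [G [uG ooG]] := @ultraFilterLemma nat \oo _.
pose met k : set nat :=
  [set i | if unpickle k is Some a then E i `&` U a !=set0 else True].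
pose S m : set nat := [set i | forall k, (k < m)%N -> met k i <-> G (met k)].
have GS m : G (S m).
  elim: m => [|m IH]; first by apply: filterS filterT => i _ k.
  have [Gm|Gm] := pselect (G (met m)).
    apply: filterS2 IH (Gm) => i Si mi k; rewrite ltnS leq_eqVlt => /orP[/eqP->|].
      by split.
    exact: Si.
  have : G (~` met m) by have [] := in_ultra_setVsetC (met m) uG.
  apply: filterS2 IH => i Si mi k; rewrite ltnS leq_eqVlt => /orP[/eqP->|].
    by split=> // Gm'; case: (Gm Gm').
  exact: Si.
have /choice[g gP] : forall m, exists g : nat -> nat, forall l, (l < g l)%N /\ S m (g l).
  move=> m; have : forall l, exists i, (l < i)%N /\ S m i.
    move=> l; apply: (@filter_ex _ G); apply: filterI (GS m).
    by apply: ooG; exists l.+1.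
  by move=> /choice[g]; exists g.
pose phi := fix phi n := if n is n'.+1 then g n (phi n') else g 0%N 0%N.
have Sphi n : S n (phi n) by case: n => [|n]; exact: (gP _ _).2.
exists phi; split; first by move=> i; exact: (gP _ _).1.
exists (outer_limit (fun i => E (phi i))); split=> //.
apply/seteqP; split=> p hp V Vp.
  move=> i0; have [i1 i1P] := hp V Vp; exists (maxn i0 i1).
  by split; [exact: leq_maxl|apply: i1P; exact: leq_maxr].
have [a [pU UV]] := baseU _ _ Vp.
have [i [ai [z [Ez Uz]]]] := hp _ pU (pickle a).+1.
have Ga : G (met (pickle a)).
  by apply/(Sphi i _ ai); rewrite /met /= pickleK; exists z.
exists (pickle a).+1 => k ak.
have : met (pickle a) (phi k) by apply/(Sphi k _ ak).
by rewrite /met /= pickleK => -[w [Ew Uw]]; exists w; split=> //; exact: UV.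
Qed.

Definition rational_ball (R : realType) (n : nat)
    (c : rat * nat * 'rV[rat]_n * nat) : set (R * nat * 'rV[R]_n) :=
  let: (q, j, v, m) := c in
  @ball R (R * nat * 'rV[R]_n)%type ((ratr q : R), j, map_mx ratr v) m.+1%:R^-1.

(** A center is chosen within r / 2 of the point, where r is the radius of
    the rational ball: the ball then contains a neighborhood of the point and
    stays within 2 r of it. *)
Lemma rational_ball_base (R : realType) (n : nat) (p : R * nat * 'rV[R]_n) V :
  nbhs p V ->
  exists c, nbhs p (@rational_ball R n c) /\ @rational_ball R n c `<=` V.
Proof.
case: p => [[t j] z] /nbhs_ballP[e /= e0 eV].
have [m me] : exists m : nat, (m.+1%:R^-1 : R) < e / 2.
  exists (Num.truncn (e / 2)^-1); rewrite invf_plt ?posrE ?ltr0n//; last lra.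
  by rewrite truncnS_gt.
set r : R := m.+1%:R^-1 in me *.
have r0 : 0 < r by rewrite invr_gt0 ltr0n.
have approx (x : R) : {q : rat | ball (ratr q : R) (r / 2) x}.
  apply: cid; have [|q] := @rat_in_itvoo R x (x + r / 2); first lra.
  by rewrite in_itv /= => /andP[xq qx]; exists q; rewrite /ball /= ger0_norm; lra.
pose q := sval (approx t); pose v := \row_i sval (approx (z ord0 i)).
have pc : @ball R (R * nat * 'rV[R]_n)%type ((ratr q : R), j, map_mx ratr v) (r / 2) (t, j, z).
  split; first by split; [exact: (svalP (approx t))|apply: ballxx; lra].
  split=> [|i k]; first lra.
  by rewrite !ord1 !mxE; exact: (svalP (approx _)).
exists (q, j, v, m); rewrite /rational_ball -/r; split.
  apply/nbhs_ballP; exists (r / 2); first by rewrite /=; lra.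
  move=> w pw; rewrite [r]splitr; exact: ball_triangle pc pw.
move=> w cw; apply: eV; apply: (@le_ball _ _ _ (r / 2 + r)); first lra.
by apply: ball_triangle cw; exact: ball_sym.
Qed.

Lemma graphical_subsequence (R : realType) (n : nat) (xs : nat -> hfun R n) :
  exists phi : nat -> nat, (forall i, (phi i < phi i.+1)%N) /\
    exists N, graphical_limit (fun i => xs (phi i)) N.
Proof.
have [phi [phiS [A cvA]]] :=
  pk_subsequence (fun i => sv_graph (hmap (xs i))) (@rational_ball_base R n).
exists phi; split=> //; exists (fun p => [set z | A (p, z)]).
suff -> : graphical_limit (fun i => xs (phi i)) (fun p => [set z | A (p, z)]) =
  pk_converges (fun i => sv_graph (hmap (xs (phi i)))) A by [].
by congr (pk_converges _ _); apply/seteqP; split=> -[].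
Qed.

(** * Graphical limits of locally eventually bounded sequences *)

Lemma prod_hausdorff (T U : topologicalType) :
  hausdorff_space T -> hausdorff_space U -> hausdorff_space (T * U)%type.
Proof.
move=> hT hU [t u] [t' u'] cl; congr pair.
  apply: hT => A B At Bt'.
  have [||[w _] [[/= Aw _] [Bw _]]] := cl (A `*` setT) (B `*` setT).
  - by exists (A, setT) => //; split=> //; exact: filterT.
  - by exists (B, setT) => //; split=> //; exact: filterT.
  - by exists w.
apply: hU => A B Au Bu'.
have [||[_ w] [[/= _ Aw] [_ Bw]]] := cl (setT `*` A) (setT `*` B).
- by exists (setT, A) => //; split=> //; exact: filterT.
- by exists (setT, B) => //; split=> //; exact: filterT.
- by exists w.
Qed.

Lemma hybrid_time_hausdorff (R : realType) : hausdorff_space (R * nat)%type.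
Proof. exact: prod_hausdorff (@Rhausdorff R) discrete_hausdorff. Qed.

Lemma hybrid_space_hausdorff (R : realType) (n : nat) :
  hausdorff_space (R * nat * 'rV[R]_n)%type.
Proof.
by apply: prod_hausdorff; [exact: hybrid_time_hausdorff|exact: norm_hausdorff].
Qed.

(** The index bound is the integer part of tau, so that the box is compact
    and contains all points (t, j, z) with t + j <= tau and z in K. *)
Definition hybrid_box (R : realType) (n : nat) (tau : R) (K : set 'rV[R]_n) :
  set (R * nat * 'rV[R]_n) :=
  (`[0, tau]%classic `*` `I_(Num.truncn tau).+1) `*` K.

Lemma hybrid_box_compact (R : realType) (n : nat) (tau : R)
    (K : set 'rV[R]_n) :
  compact K -> compact (hybrid_box tau K).
Proof.
move=> cK; apply: compact_setX => //; apply: compact_setX.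
  exact: segment_compact.
by apply: finite_compact; exact: finite_II.
Qed.

Lemma hybrid_boxP (R : realType) (n : nat) (tau : R) (K : set 'rV[R]_n) q :
  0 <= q.1.1 -> q.1.1 + q.1.2%:R <= tau -> K q.2 -> hybrid_box tau K q.
Proof.
case: q => [[t j] z] /= t0 ttau Kz; split=> //; split=> /=.
  rewrite in_itv /= t0 /=; apply: le_trans ttau.
  by rewrite lerDl ler0n.
rewrite ltnS -(ler_nat R); apply: le_trans (_ : _ <= (Num.truncn (j%:R : R))%:R) _.
  by rewrite natrK.
rewrite ler_nat; apply: le_truncn; apply: le_trans ttau.
by rewrite lerDr.
Qed.

(** The form in which local eventual boundedness is used: graph points with
    bounded hybrid time, chosen for infinitely many indices, cluster at a point
    of the graphical limit.  The predicate B records which points are chosen.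
    Asking for infinitely many indices only lets the lemma serve in arguments by
    contradiction. *)
Lemma leb_cluster (R : realType) (n : nat) (xs : nat -> hfun R n) N (tau : R)
    (B : nat -> set (R * nat * 'rV[R]_n)) :
  (forall i, hybrid_arc (xs i)) ->
  locally_eventually_bounded xs -> graphical_limit xs N ->
  (forall i, exists k, (i <= k)%N /\ exists q,
     [/\ sv_graph (hmap (xs k)) q, q.1.1 + q.1.2%:R <= tau & B k q]) ->
  exists2 p, sv_graph N p & forall V, nbhs p V -> forall i,
    exists k, (i <= k)%N /\ exists q,
     [/\ sv_graph (hmap (xs k)) q, B k q & V q].
Proof.
move=> hxs leb [_ outN] exq.
have nonneg k q : sv_graph (hmap (xs k)) q -> 0 <= q.1.1.
  by move=> [xq _]; have [[+ _ _] _] := hxs k; apply; exact: xq.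
have tau0 : 0 <= tau.
  have [k [_ [q [/nonneg q0 qtau _]]]] := exq 0%N.
  by apply: le_trans qtau; rewrite addr_ge0.
have [i0 [K [cK xK]]] := leb _ tau0.
have : forall i, exists kq : nat * (R * nat * 'rV[R]_n), (i <= kq.1)%N /\
     [/\ sv_graph (hmap (xs kq.1)) kq.2, kq.2.1.1 + kq.2.1.2%:R <= tau & B kq.1 kq.2].
  by move=> i; have [k [ik [q qP]]] := exq i; exists (k, q).
move=> /choice[f fP].
have [|p [_ clp]] := @hybrid_box_compact R n tau K cK ((snd \o f) @ \oo) _.
  exists i0 => // i /= ii0; have [ik [[dq eq] qtau _]] := fP i.
  apply: hybrid_boxP => //; first exact: (nonneg (f i).1).
  rewrite eq; apply: (xK (f i).1); first exact: leq_trans ik.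
    by rewrite -surjective_pairing.
  exact: qtau.
have clP V : nbhs p V -> forall i, exists k, (i <= k)%N /\ exists q,
     [/\ sv_graph (hmap (xs k)) q, B k q & V q].
  move=> pV i.
  have [|q [[k /= ik <-] Vq]] := clp [set (f k).2 | k in [set k | (i <= k)%N]] V _ pV.
    by exists i => // k ik; exists k.
  have [le_k [gr _ Bq]] := fP k.
  by exists (f k).1; split; [exact: leq_trans le_k|exists (f k).2].
exists p => //; rewrite -outN => V pV i.
have [k [ik [q [gr _ Vq]]]] := clP V pV i.
by exists k; split=> //; exists q.
Qed.

(** Outer limits are closed, and points of the limit are approximated by graph
    points of slightly larger hybrid time, which lie in a fixed compact box. *)
Lemma limit_graph_compact (R : realType) (n : nat) (xs : nat -> hfun R n) N
    (tau : R) :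
  (forall i, hybrid_arc (xs i)) ->
  locally_eventually_bounded xs -> graphical_limit xs N ->
  (forall p, sv_graph N p -> p.1.1 + p.1.2%:R <= tau) ->
  compact (sv_graph N).
Proof.
move=> hxs leb [_ outN] Ntau.
have [tau0|tau0] := leP 0 (tau + 1); last first.
  suff -> : sv_graph N = set0 by exact: compact0.
  rewrite -subset0 => p Np; have ptau := Ntau _ Np.
  move: Np; rewrite -outN => /(_ (ball p 1)).
  have pV : nbhs p (ball p 1) by exact: nbhsx_ballx.
  move=> /(_ pV 0%N)[i [_ [[[t j] z] [[/= xtj _] [[pt _] _]]]]].
  have [[/(_ _ xtj)/= t0 _ _] _] := hxs i.
  move: pt; rewrite /ball /= ltr_norml => /andP[pt _].
  have : (0 : R) <= p.1.2%:R by [].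
  lra.
have [i0 [K [cK xK]]] := leb _ tau0.
have cbox := @hybrid_box_compact R n (tau + 1) K cK.
apply: (subclosed_compact _ cbox).
  rewrite -outN => p clp V pV i.
  have [q [outq Vq]] := clp _ (nbhs_interior pV).
  exact: outq.
move=> p Np.
have /closure_id -> : closed (hybrid_box (tau + 1) K).
  by apply: compact_closed => //; exact: hybrid_space_hausdorff.
move=> V pV; have ptau := Ntau _ Np.
move: Np; rewrite -outN => /(_ (V `&` ball p 1)).
have pV' : nbhs p (V `&` ball p 1) by apply: filterI => //; exact: nbhsx_ballx.
move=> /(_ pV' i0)[i [ii0 [[[t j] z] [[/= xtj ->] [Vq [[pt pj] _]]]]]].
exists (t, j, xs i t j); split=> //.
have ej : p.1.2 = j by exact: pj.
have le_tau : t + j%:R <= tau + 1.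
  by rewrite -ej; move: pt; rewrite /ball /= ltr_norml => /andP[+ _]; lra.
apply: hybrid_boxP => //=; first by have [[/(_ _ xtj) + _ _] _] := hxs i.
exact: xK.
Qed.

(** * From graphical convergence to convergence of values *)

(** Every cluster point of the graph points ((ts i, js i), xs i (ts i) (js i))
    lies in the graph of [x] above (t, j), where [x] has a single value. *)
Lemma leb_value_cvg (R : realType) (n : nat) (xs : nat -> hfun R n)
    (x : hfun R n) (ts : nat -> R) (js : nat -> nat) t j :
  (forall i, hybrid_arc (xs i)) ->
  locally_eventually_bounded xs -> graphical_limit xs (hmap x) ->
  (\forall i \near \oo, hdom (xs i) (ts i, js i)) ->
  (fun i => (ts i, js i)) @ \oo --> (t, j) ->
  hdom x (t, j) /\ (fun i => xs i (ts i) (js i)) @ \oo --> x t j.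
Proof.
move=> hxs leb gl [i1 _ xtsjs] tsjs.
have timeB : \forall i \near \oo, ts i + (js i)%:R <= t + j%:R + 1.
  have near1 : \forall i \near \oo, ball (t, j) (1 : R) (ts i, js i).
    by apply: tsjs; exact: nbhsx_ballx.
  apply: filterS near1 => i [ti ji].
  have <- : j = js i by exact: ji.
  by move: ti; rewrite /ball /= ltr_norml => /andP[+ _]; lra.
have [i2 _ timeB2] := timeB.
(* Stated for infinite sets of indices: P is first trivial, then the set of
   indices at which the value stays out of a neighborhood of x t j. *)
have freq (P : nat -> Prop) : (forall i, exists k, (i <= k)%N /\ P k) ->
    hdom x (t, j) /\ forall W, nbhs (x t j) W -> exists k, P k /\ W (xs k (ts k) (js k)).
  move=> freqP.
  have [i|p Np clp] := @leb_cluster R n xs (hmap x) (t + j%:R + 1)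
      (fun k => [set q | P k /\ q.1 = (ts k, js k)]) hxs leb gl.
    have [k [ik Pk]] := freqP (maxn i (maxn i1 i2)).
    move: ik; rewrite !geq_max => /and3P[ik i1k i2k].
    exists k; split=> //; exists ((ts k, js k), xs k (ts k) (js k)); split=> //=.
      by split=> //; exact: xtsjs.
    exact: timeB2.
  have p1 : p.1 = (t, j).
    apply: hybrid_time_hausdorff => A B Ap Btj.
    have [i3 _ i3B] := tsjs _ Btj.
    have [|k [ik [q [_ [_ q1] Aq]]]] := clp (A `*` setT) _ i3.
      by exists (A, setT) => //; split=> //; exact: filterT.
    exists (ts k, js k); split; last exact: i3B.
    by rewrite -q1; exact: Aq.1.
  move: Np => [/=]; rewrite p1 /= => xtj p2; split=> // W xW.
  have [|k [_ [[q1 q2] [[/= _ eq2] [Pk /= eq1] Wq]]]] := clp (setT `*` W) _ 0%N.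
    by exists (setT, W) => //; split=> //; [exact: filterT|rewrite /= p2].
  by exists k; split=> //; move: Wq.2 => /=; rewrite eq2 eq1.
have [xtj _] := freq (fun _ => True) (fun i => ex_intro _ i (conj (leqnn i) I)).
split=> // W xW; apply: contrapT => nW.
have [|_ /(_ _ xW)[k [nWk Wk]]] := freq (fun k => ~ W (xs k (ts k) (js k))).
  move=> i; apply: contrapT => nex; apply: nW; exists i => // k /= ik.
  by apply: contrapT => nWk; apply: nex; exists k.
exact: nWk.
Qed.

Lemma cvg_sum (R : realType) (T I : Type) (F : set_system T) (s : seq I)
    (f : I -> T -> R) (l : I -> R) :
  Filter F -> (forall i, f i @ F --> l i) ->
  (fun t => \sum_(i <- s) f i t) @ F --> \sum_(i <- s) l i.
Proof.
move=> FF fl; elim: s => [|i s IH].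
  by under eq_fun do rewrite big_nil; rewrite big_nil; exact: cvg_cst.
under eq_fun do rewrite big_cons; rewrite big_cons.
by apply: cvgD.
Qed.

(** Compares the Euclidean norm, in which closeness is measured, with the sup
    norm, which defines the topology. *)
Lemma nbhs_enorm (R : realType) (n : nat) (z : 'rV[R]_n) (e : R) :
  0 < e -> nbhs z [set w | enorm (w - z) < e].
Proof.
move=> e0.
have sum_cvg : (fun w : 'rV[R]_n => \sum_i (w - z) ord0 i ^+ 2) @ z -->
    \sum_i (z - z) ord0 i ^+ 2.
  apply: (cvg_sum (nbhs_filter z)) => i.
  have coordB : (fun w : 'rV[R]_n => (w - z) ord0 i) @ z --> (z - z) ord0 i.
    rewrite (_ : (fun w : 'rV[R]_n => (w - z) ord0 i) =
        (fun w => w ord0 i - z ord0 i)); last by apply/funext => w; rewrite !mxE.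
    have -> : (z - z) ord0 i = z ord0 i - z ord0 i by rewrite !mxE.
    exact: (cvgB (@coord_continuous R 1 n ord0 i z) (cvg_cst _)).
  exact: (cvgM coordB coordB).
have : (fun w : 'rV[R]_n => enorm (w - z)) @ z --> enorm (z - z).
  exact: (cvg_comp _ _ sum_cvg (@sqrt_continuous _ _)).
rewrite subrr enorm0 => /(_ [set r | r < e]); apply.
exact: lt_nbhsl.
Qed.

Lemma ball_hybrid_close (R : realType) (n : nat) (e : R) :
  0 < e -> exists2 d : R, 0 < d & forall q w : R * nat * 'rV[R]_n, ball q d w ->
    [/\ `|q.1.1 - w.1.1| < e, q.1.2 = w.1.2 & enorm (q.2 - w.2) < e].
Proof.
move=> e0; have /nbhs_ballP[r /= r0 rP] := nbhs_enorm (0 : 'rV[R]_n) e0.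
exists (Num.min r e); first by rewrite lt_min r0.
move=> q w qw.
have [[q1 q2] _] : ball q e w by apply: le_ball qw; rewrite ge_min lexx orbT.
have [_ q3] : ball q r w by apply: le_ball qw; rewrite ge_min lexx.
split=> //.
have := rP (q.2 - w.2); rewrite /= subr0; apply.
by rewrite -ball_normE /ball_ /= sub0r normrN; move: q3; rewrite -ball_normE.
Qed.

(** Graphical convergence is pointwise in the graph; it becomes uniform
    because the graph of [x] is compact (first half) and because graph points of
    the [xs i] with bounded hybrid time cluster at it (second half). *)
Lemma leb_close (R : realType) (n : nat) (xs : nat -> hfun R n)
    (x : hfun R n) (sigma tau e : R) :
  (forall i, hybrid_arc (xs i)) ->
  locally_eventually_bounded xs -> graphical_limit xs (hmap x) ->
  (forall p, hdom x p -> p.1 + p.2%:R <= sigma) -> 0 < e ->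
  \forall i \near \oo, close_arcs tau e x (xs i).
Proof.
move=> hxs leb gl xsigma e0.
have cG : compact (sv_graph (hmap x)).
  exact: (limit_graph_compact hxs leb gl (fun p Np => xsigma _ Np.1)).
have [d d0 dP] := ball_hybrid_close n e0.
have d20 : 0 < d / 2 by lra.
have bclose (p q w : R * nat * 'rV[R]_n) : ball p (d / 2) q -> ball p (d / 2) w ->
    [/\ `|q.1.1 - w.1.1| < e, q.1.2 = w.1.2 & enorm (q.2 - w.2) < e].
  move=> pq pw; apply: dP; rewrite [d]splitr.
  exact: ball_triangle (ball_sym pq) pw.
apply: filterI.
- apply: contrapT => nclose.
  have : forall i, exists kq : nat * (R * nat * 'rV[R]_n), [/\ (i <= kq.1)%N,
      sv_graph (hmap x) kq.2 & forall w, sv_graph (hmap (xs kq.1)) w ->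
        ~ [/\ `|kq.2.1.1 - w.1.1| < e, kq.2.1.2 = w.1.2 & enorm (kq.2.2 - w.2) < e]].
    move=> i; apply: contrapT => nex; apply: nclose; exists i => // k /= ik t j xtj _.
    apply: contrapT => nex2; apply: nex; exists (k, (t, j, x t j)); split=> //=.
    move=> [[s l] z] [/= xsl ->] [ts eqjl cl]; subst l.
    by apply: nex2; exists s.
  move=> /choice[f fP].
  have [|p [Gp clp]] := cG ((snd \o f) @ \oo) _.
    by exists 0%N => // k _ /=; have [] := fP k.
  have pV : nbhs p (ball p (d / 2)) by exact: nbhsx_ballx.
  move: Gp; rewrite -gl.1 => /(_ _ pV)[i1 i1P].
  have [|_ [[k /= ik <-] Vq]] := clp [set (f k).2 | k in [set k | (i1 <= k)%N]] _ _ pV.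
    by exists i1 => // k ik; exists k.
  have [kf _ bad] := fP k.
  have [w [Gw Vw]] := i1P _ (leq_trans ik kf).
  exact: (bad _ Gw (bclose _ _ _ Vq Vw)).
- apply: contrapT => nclose.
  have [i|p Gp clp] := @leb_cluster R n xs (hmap x) tau
      (fun k => [set q | forall w, sv_graph (hmap x) w ->
        ~ [/\ `|q.1.1 - w.1.1| < e, q.1.2 = w.1.2 & enorm (q.2 - w.2) < e]])
      hxs leb gl.
    apply: contrapT => nex; apply: nclose; exists i => // k /= ik t j xtj ttau.
    apply: contrapT => nex2; apply: nex; exists k; split=> //.
    exists (t, j, xs k t j); split=> //=.
    move=> [[s l] z] [/= xsl ->] [ts eqjl cl]; subst l.
    by apply: nex2; exists s.
  have pV : nbhs p (ball p (d / 2)) by exact: nbhsx_ballx.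
  have [k [_ [q [_ bad Vq]]]] := clp _ pV 0%N.
  by apply: (bad _ Gp); apply: bclose Vq _; exact: ballxx.
Qed.

(** Outer well-posedness for the zero perturbation; its second alternative
    produces an escaping solution. *)
Lemma well_posed_limit (R : realType) (n : nat) (H : hybrid_data R n) x0
    (xs : nat -> hfun R n) N :
  outer_well_posed H x0 -> pre_forward_complete H x0 ->
  graphical_limit xs N -> (forall i, solution H (xs i)) ->
  (fun i => xs i 0 0%N) @ \oo --> x0 ->
  locally_eventually_bounded xs /\ exists2 x, solution_from H x0 x & hmap x = N.
Proof.
move=> owp pfc gl solxs cvg0.
(* The index is shifted because the scaling factors must be below 1. *)
have d01 i : 0 < (i.+2%:R^-1 : R) < 1.
  by rewrite invr_gt0 ltr0n /= invf_lt1 ?ltr0n// ltr1n.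
have d0 : (fun i => (i.+2%:R^-1 : R)) @ \oo --> (0 : R).
  by have := @cvg_harmonic R; rewrite -cvg_shiftS.
have [|||leb nleb] := owp (fun=> 0) _ xs N _ _ d01 d0 gl _ cvg0.
- by [].
- exact: cst_continuous.
- by move=> i; apply: solution_perturbation => // z; rewrite mulr0.
have [lebxs|/nleb[T [J [_ [x [_ solx esc]]]]]] := pselect (locally_eventually_bounded xs).
  by split=> //; exact: leb.
by case: (no_escape pfc solx esc).
Qed.

(** The closure of the graph of [x] is the graphical limit of the constant
    sequence [x], hence the graph of a solution extending [x]; by maximality the
    graph of [x] is closed.  Local eventual boundedness of the constant sequence
    carries closedness over to the domain. *)
Lemma maximal_solution_closed (R : realType) (n : nat) (H : hybrid_data R n) x0
    (x : hfun R n) :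
  outer_well_posed H x0 -> pre_forward_complete H x0 ->
  maximal_solutions H x0 x -> closed (hdom x).
Proof.
move=> owp pfc [[solx x00] maxx].
pose N p : set 'rV[R]_n := [set z | closure (sv_graph (hmap x)) (p, z)].
have gl : graphical_limit (fun=> x) N.
  split; apply/seteqP; split=> -[p z].
  - by move=> h V Vp; have [i0 /(_ i0 (leqnn i0))] := h V Vp.
  - by move=> h V Vp; exists 0%N => i _; exact: h.
  - by move=> h V Vp; have [i [_]] := h V Vp 0%N.
  - by move=> h V Vp i; exists i; split=> //; exact: h.
have [||leb [y [soly _] Ny]] := well_posed_limit owp pfc gl.
- by [].
- by rewrite x00; exact: cvg_cst.
have xN : hmap x = N.
  rewrite -Ny; apply/esym/maxx => //; rewrite Ny => p Gp.
  by case: p Gp => p z; exact: subset_closure.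
rewrite -xN in gl.
have hx : hybrid_arc x by case: solx.
move=> p clp.
have [i|q [xq _] clq] := @leb_cluster R n (fun=> x) (hmap x) (p.1 + p.2%:R + 1)
    (fun k => [set q | ball p (k.+1%:R^-1 : R) q.1]) (fun=> hx) leb gl.
  exists i; split=> //.
  have i0 : 0 < (i.+1%:R^-1 : R) by rewrite invr_gt0 ltr0n.
  have [s [xs ps]] := clp _ (nbhsx_ballx p _ i0).
  exists (s, x s.1 s.2); split=> //=.
  have i1 : (i.+1%:R^-1 : R) <= 1 by rewrite invf_le1 ?ltr0n// ler1n.
  have [s1 s2] := ps; have <- : p.2 = s.2 by exact: s2.
  have {}s1 : `|p.1 - s.1| < (1 : R) by exact: lt_le_trans s1 i1.
  have le1 : s.1 <= p.1 + 1 by move: s1; rewrite ltr_norml => /andP[+ _]; lra.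
  by rewrite addrAC lerD2r.
suff -> : p = q.1 by [].
apply: hybrid_time_hausdorff => A B Ap Bq.
have /nbhs_ballP[e /= e0 eA] := Ap.
have [|k [ik [w [_ pw Bw]]]] := clq (B `*` setT) _ (Num.truncn e^-1).
  by exists (B, setT) => //; split=> //; exact: filterT.
exists w.1; split; last exact: Bw.1.
apply: eA; apply: le_ball pw.
rewrite invf_ple ?posrE ?ltr0n//; apply: le_trans (ltW (truncnS_gt _)) _.
by rewrite ler_nat.
Qed.

(** * Competitors and limits of optimal solutions *)

(** If the domain did not go beyond time T, then (T, J) would be its terminal
    time, as a later jump index at time T would make T a jump time.  Likewise the
    flow interval can neither begin nor end at T, unless T is the initial time. *)
Lemma regular_time_interior (R : realType) (n : nat) (x : hfun R n) T J :
  hybrid_time_domain (hdom x) -> hdom x (0, 0%N) -> hdom x (T, J) ->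
  ~ jump_time x T -> ~ terminal_ordinary_time x T ->
  exists2 d : R, 0 < d & hdom x (T + d, J) /\
    (hdom x (T - d, J) \/ (T = 0 /\ J = 0%N)).
Proof.
move=> hE x00 xTJ njump nterm.
have [dom0 _ cmp] := hE.
have [d1 d10 xd1] : exists2 d : R, 0 < d & hdom x (T + d, J).
  have [[t j] xtj Tt] : exists2 p, hdom x p & T < p.1.
    apply: contrapT => nex.
    have le_T p : hdom x p -> p.1 <= T.
      by move=> xp; rewrite leNgt; apply/negP => Tp; apply: nex; exists p.
    have xpast : hdom x = hdom x `&` past T J.
      apply/seteqP; split=> [[t j] xtj|p []//]; split=> //; split; first exact: le_T xtj.
      rewrite /= leqNgt; apply/negP => Jj.
      have [r [Tr rt xr xr1]] := exists_jump_after hE xTJ xtj Jj.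
      have rT : r = T by apply/le_anti; rewrite Tr andbT; exact: le_T xr.
      by apply: njump; exists J; rewrite -rT.
    apply: nterm; exists J; split=> //; first by rewrite xpast; exact: truncation_compact.
    by move=> p; rewrite xpast => -[].
  have [[/=]|[/= _ Jj]] := cmp _ _ xtj xTJ; first by rewrite leNgt Tt.
  move: Jj; rewrite leq_eqVlt => /orP[/eqP eqJ|Jj].
    by exists (t - T); [rewrite subr_gt0|rewrite addrC subrK eqJ].
  have [r [Tr rt xr xr1]] := exists_jump_after hE xTJ xtj Jj.
  exists (r - T); last by rewrite addrC subrK.
  rewrite subr_gt0 lt_neqAle Tr andbT; apply/negP => /eqP eqT.
  by apply: njump; exists J; rewrite eqT.
have shrink d : 0 < d <= d1 -> hdom x (T + d, J).
  move=> /andP[dd0 dd1]; apply: (flow_interval_convex hE xTJ xd1).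
  by apply/andP; split; lra.
have [t [t0 tle tT tE]] := time_domain_grid hE xTJ.
have [xtJ tJT] : hdom x (t J, J) /\ t J <= T by apply/tE; rewrite // lexx tle.
move: tJT; rewrite le_eqVlt => /orP[/eqP eqT|ltT]; last first.
  exists (Num.min d1 (T - t J)); first by rewrite lt_min d10 subr_gt0.
  split; first by apply: shrink; rewrite ge_min lexx lt_min d10 subr_gt0 ltT.
  left; apply: (flow_interval_convex hE xtJ xTJ).
  have : Num.min d1 (T - t J) <= T - t J by rewrite ge_min lexx orbT.
  have : 0 < Num.min d1 (T - t J) by rewrite lt_min d10 subr_gt0.
  by move=> ? ?; apply/andP; split; lra.
case: J xTJ xd1 shrink t0 tle tT tE xtJ eqT => [|J] xTJ xd1 shrink t0 tle tT tE xtJ eqT.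
  by exists d1 => //; split=> //; right; rewrite -eqT.
exfalso; apply: njump; exists J; split=> //; rewrite -eqT.
by apply: (proj2 (tE (t J.+1) J (leqnSn J)) _).1; rewrite lexx tle.
Qed.

(** Inner well-posedness provides solutions from the points xi i that converge
    to [x].  Since T is interior, relative to nonnegative times, to the flow
    interval of [x] with index J, these solutions have points at index J on both
    sides of ts i, hence are defined at (ts i, js i), where they are
    truncated. *)
Lemma exists_competitors (R : realType) (n : nat) (H : hybrid_data R n) x0
    (x : hfun R n) T J (xi : nat -> 'rV[R]_n) (ts : nat -> R) (js : nat -> nat) :
  outer_well_posed H x0 -> nominally_inner_well_posed H x0 ->
  pre_forward_complete H x0 ->
  maximal_solutions H x0 x -> hdom x (T, J) ->
  ~ jump_time x T -> ~ terminal_ordinary_time x T ->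
  (forall i, (closure (flow_set H) `|` jump_set H) (xi i)) ->
  xi @ \oo --> x0 ->
  (forall i, 0 <= ts i) -> (fun i => (ts i, js i)) @ \oo --> (T, J) ->
  exists2 ys : nat -> hfun R n,
    \forall i \near \oo, [/\ solution_from H (xi i) (ys i) &
      terminal_hybrid_time (ys i) (ts i, js i)] &
    (fun i => ys i (ts i) (js i)) @ \oo --> x T J.
Proof.
move=> owp iwp pfc maxx xTJ njump nterm xiCD xi0 ts0 tsjs.
have [[solx x00] _] := maxx.
have xi0' : xi @ \oo --> x 0 0%N by rewrite x00.
have [xs [solxs + _]] := iwp x (conj solx x00) xi xiCD xi0'.
move=> /(_ (pfc x maxx) (maximal_solution_closed owp pfc maxx))[leb gl].
have hxs i : hybrid_arc (xs i) by have [[]] := solxs i.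
have [[hE _] [x0dom _] _ _ _] := solx.
have [d d0 [xTd xTd']] := regular_time_interior hE x0dom xTJ njump nterm.
have d20 : 0 < d / 2 by lra.
have approx s : hdom x (s, J) -> \forall i \near \oo, exists2 r,
    `|s - r| < d / 2 & hdom (xs i) (r, J).
  move=> xs_.
  have : sv_graph (hmap x) ((s, J), x s J) by [].
  rewrite -gl.1 => /(_ _ (nbhsx_ballx _ _ d20))[i0 i0P].
  exists i0 => // i /= ii0.
  have [[[r j] z] [[/= xr _] [[sr Jj] _]]] := i0P _ ii0.
  by exists r => //; have -> : J = j by exact: Jj.
have near_tsjs : \forall i \near \oo, `|T - ts i| < d / 2 /\ J = js i.
  have near_ball : \forall i \near \oo, ball (T, J) (d / 2) (ts i, js i).
    by apply: tsjs; exact: nbhsx_ballx.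
  by apply: filterS near_ball => i [].
have xsdom : \forall i \near \oo, hdom (xs i) (ts i, js i).
  (* On the left, the initial point serves when T = 0, as ts i >= 0. *)
  have low : \forall i \near \oo, exists2 r, r <= ts i & hdom (xs i) (r, J).
    case: xTd' => [xTd'|[T0 J0]].
      apply: filterS2 (approx _ xTd') near_tsjs => i [r rT xr] [tsT _].
      by exists r => //; move: rT tsT; rewrite !ltr_norml => /andP[? ?] /andP[? ?]; lra.
    apply: filterS filterT => i _; exists 0 => //; rewrite J0.
    by have [[_ [? _] _ _ _] _] := solxs i.
  apply: filterS3 low (approx _ xTd) near_tsjs => i [r rts xr] [s sT xs_] [tsT <-].
  apply: (flow_interval_convex (hxs i).1 xr xs_); rewrite rts /=.
  by move: sT tsT; rewrite !ltr_norml => /andP[? ?] /andP[? ?]; lra.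
exists (fun i => truncate (xs i) (ts i) (js i)); last first.
  exact: (leb_value_cvg hxs leb gl xsdom tsjs).2.
apply: filterS xsdom => i xsi; have [solxi xi00] := solxs i; split.
  by split=> //; exact: solution_truncate.
exact: truncate_terminal solxi xsi.
Qed.

(** Costs of feasible solutions are nonnegative, so their infimum is a genuine
    lower bound and attaining it means being below every competitor. *)
Lemma optimalP (R : realType) (n : nat) (H : hybrid_data R n)
    (cost : endpoint_data R n -> R) x0 T J (x : hfun R n) :
  cost_function cost -> 0 <= T ->
  optimal_solutions H cost x0 T J x <->
  [/\ solution_from H x0 x, terminal_hybrid_time x (T, J) &
      forall y, solution_from H x0 y -> terminal_hybrid_time y (T, J) ->
        cost (x0, (T, J), x T J) <= cost (x0, (T, J), y T J)].
Proof.
move=> cost0 T0.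
have feasP y h : feasible_at H ([set x0] `*` [set (T, J)] `*` setT) y h <->
    [/\ solution_from H x0 y, terminal_hybrid_time y (T, J) & h = (T, J)].
  split=> [[[soly cy] ty [[/= y0 hTJ] _]]|[[soly y0] ty ->]].
    by split=> //; rewrite -hTJ.
  split=> //; first by split=> //; have [] := ty.
rewrite /optimal_solutions /optimal; set S := (X in inf X).
have SP c : S c <-> exists y, [/\ solution_from H x0 y,
    terminal_hybrid_time y (T, J) & c = cost (x0, (T, J), y T J)].
  split=> [[y [h [/feasP[soly ty ->] ->]]]|[y [soly ty ->]]].
    by exists y; split=> //; rewrite /endpoints soly.2.
  exists y, (T, J); split; first exact/feasP.
  by rewrite /endpoints soly.2.
have lbS : lbound S 0 by move=> c /SP[y [_ _ ->]]; exact: cost0.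
split=> [[h /feasP[solx tx ->]]|[solx tx opt]].
  rewrite /endpoints solx.2 /= => costx; split=> // y soly ty; rewrite costx.
  by apply: ge_inf; [exists 0|apply/SP; exists y].
exists (T, J); first exact/feasP.
rewrite /endpoints solx.2 /=; apply/le_anti/andP; split.
  apply: lb_le_inf; first by exists (cost (x0, (T, J), x T J)); apply/SP; exists x.
  by move=> c /SP[y [soly ty ->]]; exact: opt.
by apply: ge_inf; [exists 0|apply/SP; exists x].
Qed.

Lemma cost_cvg (R : realType) (n : nat) (cost : endpoint_data R n -> R)
    x0 T J z (xi zs : nat -> 'rV[R]_n) (ts : nat -> R) (js : nat -> nat) :
  cost_continuous_at cost (x0, (T, J), z) ->
  xi @ \oo --> x0 -> (forall i, 0 <= ts i) ->
  (fun i => (ts i, js i)) @ \oo --> (T, J) -> zs @ \oo --> z ->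
  (fun i => cost (xi i, (ts i, js i), zs i)) @ \oo --> cost (x0, (T, J), z).
Proof.
move=> cc xi0 ts0 tsjs zsz.
have pcvg : (fun i => (xi i, (ts i, js i), zs i)) @ \oo --> (x0, (T, J), z).
  exact: cvg_pair (cvg_pair xi0 tsjs) zsz.
move=> W /cc W1.
have nearW : \forall i \near \oo,
    0 <= ts i -> W (cost (xi i, (ts i, js i), zs i)) by exact: (pcvg _ W1).
by apply: filterS nearW => i; apply.
Qed.

(** The limit is feasible by convergence of terminal values.  A competitor y
    is replaced by a regular solution with the same endpoint, which is
    approximated by competitors of the xs i; the inequalities between costs pass
    to the limit by continuity of the cost at (x0, (T, J), -). *)
Lemma optimal_graphical_limit (R : realType) (n : nat) (H : hybrid_data R n)
    (x0 : 'rV[R]_n) (T : R) (J : nat) (cost : endpoint_data R n -> R)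
    (xs : nat -> hfun R n) (xi : nat -> 'rV[R]_n) (ts : nat -> R)
    (js : nat -> nat) N :
  outer_well_posed H x0 -> nominally_inner_well_posed H x0 ->
  pre_forward_complete H x0 ->
  (forall xi, reachable_set H x0 T J xi ->
       exists x, [/\ maximal_solutions H x0 x, hdom x (T, J), xi = x T J,
                     ~ jump_time x T & ~ terminal_ordinary_time x T]) ->
  cost_function cost ->
  (forall xi, cost_continuous_at cost (x0, (T, J), xi)) ->
  0 <= T -> (forall i, 0 <= ts i) ->
  graphical_limit xs N ->
  (forall i, optimal_solutions H cost (xi i) (ts i) (js i) (xs i)) ->
  xi @ \oo --> x0 ->
  (fun i => (ts i, js i)) @ \oo --> (T, J) ->
  locally_eventually_bounded xs /\
  exists2 x, optimal_solutions H cost x0 T J x & hmap x = N.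
Proof.
move=> owp iwp pfc reg cost0 ccont T0 ts0 gl optxs xi0 tsjs.
have opt i := (optimalP H (xi i) (js i) (xs i) cost0 (ts0 i)).1 (optxs i).
have solxs i : solution H (xs i) by have [[]] := opt i.
have x0xi : (fun i => xs i 0 0%N) = xi.
  by apply/funext => i; have [[]] := opt i.
have [|leb [x solx xN]] := well_posed_limit owp pfc gl solxs; first by rewrite x0xi.
split=> //; exists x => //; rewrite -xN in gl.
have hxs i : hybrid_arc (xs i) by have [] := solxs i.
have [xTJ cvgx] := leb_value_cvg hxs leb gl
  (filterS (fun i _ => let: And3 _ (And3 _ h _) _ := opt i in h) filterT) tsjs.
have xpast p : hdom x p -> p.1 <= T /\ (p.2 <= J)%N.
  case: p => t j xtj.
  have Gx : sv_graph (hmap x) ((t, j), x t j) by [].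
  have approx e : 0 < e -> t <= T + e /\ (j <= J)%N.
    move=> e0; have e20 : 0 < e / 2 by lra.
    move: Gx; rewrite -gl.1 => /(_ _ (nbhsx_ballx _ _ e20))[i0 i0P].
    have [i1 _ i1P] : \forall i \near \oo, ball (T, J) (e / 2) (ts i, js i).
      by apply: tsjs; exact: nbhsx_ballx.
    have [[[s l] z] [[/= xsl _] [[st lj] _]]] := i0P _ (leq_maxl i0 i1).
    have [Tts Jjs] := i1P _ (leq_maxr i0 i1).
    have [_ [_ _ /(_ _ xsl)[/= sts ljs]] _] := opt (maxn i0 i1).
    have jl : j = l := lj; have Jjs' : J = js (maxn i0 i1) := Jjs.
    split; last by rewrite jl Jjs'.
    by move: st Tts; rewrite /ball /= !ltr_norml => /andP[? ?] /andP[? ?]; lra.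
  split; last exact: (approx 1 ltr01).2.
  by apply/ler_addgt0Pr => e e0; exact: (approx e e0).1.
have hE : hybrid_time_domain (hdom x) by case: solx => -[[]].
have termx : terminal_hybrid_time x (T, J).
  split=> //; have -> : hdom x = hdom x `&` past T J.
    by apply/seteqP; split=> [p xp|p []//]; split=> //; exact: xpast.
  exact: truncation_compact.
apply/optimalP => //; split=> // y soly termy.
have [y' maxy' yy'] := exists_maximal_extension soly.1.
have [_ yTJ _] := termy.
have [y'TJ eqTJ] := (extendsP y y').1 yy' _ _ yTJ.
have reachy : reachable_set H x0 T J (y T J).
  by exists y'; rewrite -soly.2.
have [w [maxw wTJ -> njump nterm]] := reg _ reachy.
have xiCD i : (closure (flow_set H) `|` jump_set H) (xi i).
  by have [[[_ [_ h] _ _ _] <-] _ _] := opt i.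
have [ys ysP cvgy] := exists_competitors owp iwp pfc maxw wTJ njump nterm xiCD xi0 ts0 tsjs.
apply: ler_cvg_to (cost_cvg (ccont _) xi0 ts0 tsjs cvgx)
  (cost_cvg (ccont _) xi0 ts0 tsjs cvgy) _.
apply: filterS ysP => i [soli termi].
by have [_ _] := opt i; apply.
Qed.

Lemma cvg_of_cball (R : realType) (n : nat) (x0 : 'rV[R]_n)
    (xi : nat -> 'rV[R]_n) :
  (forall i, cball x0 (i.+1%:R^-1) (xi i)) -> xi @ \oo --> x0.
Proof.
move=> xiP; apply/cvg_ballP => e e0.
have : \forall i \near \oo, (i.+1%:R^-1 : R) < e.
  by have /cvgr_lt := @cvg_harmonic R; apply.
apply: filterS => i ie; split=> // k l; rewrite !ord1.
apply: le_lt_trans ie; apply: le_trans (xiP i).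
by have := coord_le_enorm (xi i - x0) l; rewrite !mxE distrC.
Qed.

Lemma hdist_le (R : realType) (p q : R * nat) (e : R) :
  hdist p q <= e -> `|p.1 - q.1| <= e /\ (`|p.2%:R - q.2%:R| : R) <= e.
Proof.
move=> h; split; apply: le_trans h; rewrite /hdist -sqrtr_sqr ler_sqrt;
  by rewrite ?addr_ge0 ?sqr_ge0// ?lerDl ?lerDr sqr_ge0.
Qed.

Lemma cvg_of_hdist (R : realType) (T : R) (J : nat) (ts : nat -> R)
    (js : nat -> nat) :
  (forall i, hdist (ts i, js i) (T, J) <= i.+1%:R^-1) ->
  (fun i => (ts i, js i)) @ \oo --> (T, J).
Proof.
move=> tsP; apply/cvg_ballP => e e0.
have : \forall i \near \oo, (i.+1%:R^-1 : R) < Num.min e 1.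
  by have /cvgr_lt := @cvg_harmonic R; apply; rewrite lt_min e0 ltr01.
apply: filterS => i; rewrite lt_min => /andP[ie i1].
have [/= h1 h2] := hdist_le (tsP i).
split; first by rewrite /ball /= distrC; exact: le_lt_trans ie.
suff -> : js i = J by exact: ballxx.
have : (`|(js i)%:R - J%:R| : R) < 1 by exact: le_lt_trans i1.
rewrite ltr_norml => /andP[lo hi].
have [jJ|Jj|//] := ltngtP (js i) J.
  have : ((js i).+1%:R : R) <= J%:R by rewrite ler_nat.
  by rewrite -natr1 => ?; exfalso; lra.
have : (J.+1%:R : R) <= (js i)%:R by rewrite ler_nat.
by rewrite -natr1 => ?; exfalso; lra.
Qed.

(** * The theorem *)

Lemma subseq_ge (phi : nat -> nat) :
  (forall i, (phi i < phi i.+1)%N) -> forall i, (i <= phi i)%N.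
Proof. by move=> phiS; elim=> // i /leq_ltn_trans; apply. Qed.

Lemma inv_subseq_le (R : realType) (i k : nat) :
  (i <= k)%N -> (k.+1%:R^-1 : R) <= i.+1%:R^-1.
Proof. by move=> ik; rewrite lef_pV2 ?posrE ?ltr0n// ler_nat. Qed.


Theorem corollary16 (R : realType) (n : nat) (H : hybrid_data R n)
    (x0 : 'rV[R]_n) (T : R) (J : nat) (cost : endpoint_data R n -> R)
    (H_system : is_hybrid_system H)
    (H_outer : outer_well_posed H x0)
    (H_inner : nominally_inner_well_posed H x0)
    (H_complete : pre_forward_complete H x0)
    (T_ge0 : 0 <= T)
    (reach_neq0 : reachable_set H x0 T J !=set0)
    (reach_regular : forall xi, reachable_set H x0 T J xi ->
       exists x, [/\ maximal_solutions H x0 x, hdom x (T, J), xi = x T J,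
                     ~ jump_time x T & ~ terminal_ordinary_time x T])
    (cost_ok : cost_function cost)
    (cost_cont : forall xi, cost_continuous_at cost (x0, (T, J), xi)) :
  (exists (e : R) (K : set 'rV[R]_n), [/\ 0 < e, compact K &
     forall (x0' : 'rV[R]_n) (T' : R) (J' : nat),
       cball x0 e x0' -> 0 <= T' -> hdist (T', J') (T, J) <= e ->
       forall x, optimal_solutions H cost x0' T' J' x ->
       forall t j, hdom x (t, j) -> K (x t j)]) /\
  (forall (xs : nat -> hfun R n) (xi : nat -> 'rV[R]_n) (Ts : nat -> R)
          (Js : nat -> nat) (N : R * nat -> set 'rV[R]_n),
     graphical_limit xs N ->
     (forall i, optimal_solutions H cost (xi i) (Ts i) (Js i) (xs i)) ->
     xi @ \oo --> x0 ->
     (fun i => (Ts i, Js i)) @ \oo --> (T, J) ->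
     exists2 x, optimal_solutions H cost x0 T J x & hmap x = N) /\
  (forall tau e : R, 0 <= tau -> 0 < e ->
     exists2 eta : R, 0 < eta &
       forall (x0' : 'rV[R]_n) (T' : R) (J' : nat),
         cball x0 eta x0' -> 0 <= T' -> hdist (T', J') (T, J) <= eta ->
         forall x', optimal_solutions H cost x0' T' J' x' ->
         exists2 x, optimal_solutions H cost x0 T J x &
           close_arcs tau e x x').
Proof.
have inv0 i : 0 < (i.+1%:R^-1 : R) by rewrite invr_gt0 ltr0n.
(* The common core of both arguments by contradiction: optimal solutions for
   data within 1 / (i + 1) of (x0, (T, J)) have a subsequence converging to an
   optimal solution for the limit data. *)
have extract (xi : nat -> 'rV[R]_n) (ts : nat -> R) (js : nat -> nat)
    (xs : nat -> hfun R n) :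
  (forall i, [/\ cball x0 i.+1%:R^-1 (xi i), 0 <= ts i,
     hdist (ts i, js i) (T, J) <= i.+1%:R^-1 &
     optimal_solutions H cost (xi i) (ts i) (js i) (xs i)]) ->
  exists phi : nat -> nat, (forall i, (i <= phi i)%N) /\
    locally_eventually_bounded (xs \o phi) /\
    exists2 x, optimal_solutions H cost x0 T J x &
      graphical_limit (xs \o phi) (hmap x).
  move=> xsP; have [phi [phiS [N gl]]] := graphical_subsequence xs.
  have phi_ge := subseq_ge phiS.
  exists phi; split=> //.
  have [||||leb [x optx xN]] := @optimal_graphical_limit R n H x0 T J cost (xs \o phi)
    (xi \o phi) (ts \o phi) (js \o phi) N H_outer H_inner H_complete
    reach_regular cost_ok cost_cont T_ge0 _ gl _ _ _.
  - by move=> i /=; have [] := xsP (phi i).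
  - by move=> i /=; have [] := xsP (phi i).
  - apply: cvg_of_cball => i /=; have [h _ _ _] := xsP (phi i).
    exact: le_trans h (inv_subseq_le _ (phi_ge i)).
  - apply: cvg_of_hdist => i /=; have [_ _ h _] := xsP (phi i).
    exact: le_trans h (inv_subseq_le _ (phi_ge i)).
  - by split=> //; exists x => //; rewrite xN.
split; [|split].
- apply: contrapT => nbd.
  (* The balls Kb i exhaust the space, so optimal solutions leaving them
     contradict local eventual boundedness. *)
  pose Kb (i : nat) : set 'rV[R]_n := closed_ball (0 : 'rV[R]_n) i.+1%:R.
  have cKb i : compact (Kb i).
    apply: bounded_closed_compact; last exact: closed_ball_closed.
    exists i.+1%:R; split; first exact: num_real.
    move=> r ir v; rewrite /Kb closed_ballE ?ltr0n// /closed_ball_ /= sub0r normrN.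
    by move/le_trans; apply; exact: ltW.
  have : forall i, exists d : 'rV[R]_n * R * nat * hfun R n,
      [/\ cball x0 i.+1%:R^-1 d.1.1.1, 0 <= d.1.1.2,
       hdist (d.1.1.2, d.1.2) (T, J) <= i.+1%:R^-1,
       optimal_solutions H cost d.1.1.1 d.1.1.2 d.1.2 d.2 &
       exists p, hdom d.2 p /\ ~ Kb i (d.2 p.1 p.2)].
    move=> i; apply: contrapT => nex; apply: nbd; exists i.+1%:R^-1, (Kb i).
    split=> // x0' T' J' h1 h2 h3 x h4 t j xtj; apply: contrapT => nK; apply: nex.
    by exists (x0', T', J', x); split=> //; exists (t, j).
  move=> /choice[d dP].
  have [i|phi [phi_ge [leb _]]] := extract (fun i => (d i).1.1.1) (fun i => (d i).1.1.2)
      (fun i => (d i).1.2) (fun i => (d i).2).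
    by have [] := dP i.
  (* Terminal times are within 1 of (T, J) in each component. *)
  have tau0 : 0 <= T + J%:R + 2 by rewrite !addr_ge0.
  have [i0 [K [/compact_bounded[M [_ /(_ (M + 1))KM]] xK]]] := leb _ tau0.
  have {}KM : forall v, K v -> `|v| <= M + 1 by apply: KM; lra.
  pose m := maxn i0 (Num.truncn `|M + 1|).+1.
  have [_ T0' hd opt [[t j] [xtj nK]]] := dP (phi m).
  apply: nK; rewrite /Kb closed_ballE ?ltr0n//= /closed_ball_ /= sub0r normrN.
  have [_ [_ _ /(_ _ xtj)[/= tT jJ]] _] := (optimalP H _ _ _ cost_ok T0').1 opt.
  have [/= hT hJ] := hdist_le hd.
  have le1 : ((phi m).+1%:R^-1 : R) <= 1 by rewrite invf_le1 ?ltr0n// ler1n.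
  have bT : (d (phi m)).1.1.2 <= T + 1.
    by have := le_trans hT le1; rewrite ler_norml => /andP[? ?]; lra.
  have bJ : ((d (phi m)).1.2%:R : R) <= J%:R + 1.
    by have := le_trans hJ le1; rewrite ler_norml => /andP[? ?]; lra.
  have jJ' : (j%:R : R) <= (d (phi m)).1.2%:R by rewrite ler_nat.
  have Kx : K ((d (phi m)).2 t j).
    by apply: (xK m _ t j xtj); [exact: leq_maxl|lra].
  apply: le_trans (KM _ Kx) _; apply: le_trans (ler_norm (M + 1)) _.
  apply: le_trans (ltW (truncnS_gt _)) _; rewrite ler_nat.
  by apply: leqW; apply: leq_trans (phi_ge m); exact: leq_maxr.
- move=> xs xi ts js N gl opt xi0 tsjs.
  have ts0 i : 0 <= ts i.
    have [h [[solx _] [_ xh _] [[_ hT] _]] _] := opt i.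
    have eh : h = (ts i, js i) := hT.
    by have [[[/(_ _ xh) + _ _] _] _ _ _ _] := solx; rewrite eh.
  by have [_] := optimal_graphical_limit H_outer H_inner H_complete reach_regular cost_ok
    cost_cont T_ge0 ts0 gl opt xi0 tsjs.
- move=> tau e tau0 e0; apply: contrapT => neta.
  have : forall i, exists d : 'rV[R]_n * R * nat * hfun R n,
      [/\ cball x0 i.+1%:R^-1 d.1.1.1, 0 <= d.1.1.2,
       hdist (d.1.1.2, d.1.2) (T, J) <= i.+1%:R^-1,
       optimal_solutions H cost d.1.1.1 d.1.1.2 d.1.2 d.2 &
       forall x, optimal_solutions H cost x0 T J x -> ~ close_arcs tau e x d.2].
    move=> i; apply: contrapT => nex; apply: neta; exists i.+1%:R^-1 => //.
    move=> x0' T' J' h1 h2 h3 x' h4; apply: contrapT => ncl; apply: nex.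
    exists (x0', T', J', x'); split=> // x optx cl; apply: ncl.
    by exists x.
  move=> /choice[d dP].
  have [i|phi [_ [leb [x optx gl]]]] := extract (fun i => (d i).1.1.1) (fun i => (d i).1.1.2)
      (fun i => (d i).1.2) (fun i => (d i).2).
    by have [] := dP i.
  have [_ [_ _ xpast] _] := (optimalP H x0 J x cost_ok T_ge0).1 optx.
  have harc i : hybrid_arc (((fun i => (d i).2) \o phi) i).
    by have [_ _ _ [h [[[? _] _ _]] _] _] := dP (phi i).
  have xbound p : hdom x p -> p.1 + p.2%:R <= T + J%:R.
    by move=> /xpast[? ?]; rewrite lerD ?ler_nat.
  have [i0 _ i0P] := leb_close tau harc leb gl xbound e0.
  have [_ _ _ _ ncl] := dP (phi i0).
  exact: (ncl x optx (i0P i0 (leqnn i0))).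
Qed.
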